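(* Let $I \subset \mathbb{R}$ be a compact interval, let $\mathcal{F}$ be a set of $n$ 1-independent analytic functions, and let $A$ be a finite subset of $I$. Then there is a function $f \in \mathcal{F}$ satisfying $$|2^{n-1}f(A)-(2^{n-1}-1)f(A)|\gg_{\mathcal{F},I} |A|^{\phi(n)},$$ where $\phi:\mathbb{N} \to \mathbb{R}$ is given by $\phi(1)=1$ and $\phi(n)=1+\frac{1}{1+\frac{1}{\phi(n-1)}}$ for $n\geq 2$.
   Context: For finite $B \subset \mathbb{R}$ and positive integers $s,t$, $sB - tB$ denotes the set of all $b_1+\dots+b_s - b_1'-\dots-b_t'$ with all $b_i, b_j' \in B$ (and $1B-0B=B$). ''Analytic'' means real analytic on an open interval containing $I$. A set $\{f_1,\dots,f_n\}$ of analytic functions is called 1-independent if its derivatives $f_1',\dots,f_n'$ are linearly independent over $\mathbb{R}$. $X \gg_{z} Y$ means $X \geq C(z)\, Y$ for some positive constant $C(z)$ depending only on $z$. *)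

(* Defs.v *)
From HB Require Import structures.
From mathcomp Require Import all_boot all_order all_algebra finmap.
From mathcomp Require Import all_classical all_reals all_analysis.

Set Implicit Arguments.
Unset Strict Implicit.
Unset Printing Implicit Defensive.

Import Order.TTheory GRing.Theory Num.Theory numFieldNormedType.Exports.

Local Open Scope classical_set_scope.
Local Open Scope ring_scope.

Definition analytic_at (R : realType) (f : R -> R) (x0 : R) : Prop :=
  exists2 r : R, 0 < r & exists c : nat -> R,
    forall x, `|x - x0| < r -> pseries c (x - x0) @ \oo --> f x.

Definition analytic_on (R : realType) (D : set R) (f : R -> R) : Prop :=
  forall x, D x -> analytic_at f x.

Definition linearly_independent_on (R : realType) (D : set R) (n : nat)
    (g : 'I_n -> R -> R) : Prop :=
  forall c : 'I_n -> R,
    (forall x, D x -> \sum_(i < n) c i * g i x = 0) -> forall i, c i = 0.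

Definition one_independent_on (R : realType) (D : set R) (n : nat)
    (f : 'I_n -> R -> R) : Prop :=
  linearly_independent_on D (fun i => derive1 (f i)).

(* s B - t B; the value at (s, t) = (1, 0) is B, since empty sums are 0. *)
Definition sumdiff (R : realType) (s t : nat) (B : {fset R}) : {fset R} :=
  [fset \sum_(i < s) fsval (tnth u i) - \sum_(j < t) fsval (tnth v j)
    | u in {: s.-tuple B}, v in {: t.-tuple B}]%fset.

(* The value at 0 is a dummy: the recursion starts at phi 1 = 1. *)
Fixpoint phi (R : realType) (n : nat) : R :=
  match n with
  | 0%N | 1%N => 1
  | m.+1 => 1 + 1 / (1 + 1 / phi R m)
  end.

Lemma sumdiff10 (R : realType) (B : {fset R}) : sumdiff 1 0 B = B.
Proof.
apply/fsetP => x; apply/imfset2P/idP => [[u _ [v _ ->]]|xB].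
  by rewrite big_ord1 big_ord0 subr0 (valP (tnth u ord0)).
exists [tuple [` xB]%fset] => //.
exists [tuple] => //.
by rewrite big_ord1 big_ord0 subr0.
Qed.

Lemma phi1 (R : realType) : phi R 1 = 1.
Proof. by []. Qed.

Lemma phiS (R : realType) (n : nat) :
  (1 < n)%N -> phi R n = 1 + 1 / (1 + 1 / phi R n.-1).
Proof. by case: n => [|[|n]]. Qed.

(* Main.v *)
(* Near a point [x0] (on either side of it, with [x] the distance to [x0])
   Gaussian elimination on the power series of the derivatives writes, after
   reordering, [f_i' = \sum_(j <= i) L i j * e_j] where [L] is unitriangular and
   [e_j] behaves like [c_j x^(mu_j)], together with its derivatives, for strictly
   increasing exponents [mu_j]. The bound is proved by induction on the number
   of functions, uniformly over all such systems on intervals close to [0].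

   Let [succ a] be the successor of [a] in [A]. If the gaps
   [f_0 (succ a) - f_0 a] have large rank among all gaps, adding to [f_0 a] the
   gaps that are at most its own gap already gives many elements of
   [2 f_0(A) - f_0(A)]. Otherwise few values [d] of the gap account for a positive
   proportion of [A]. On the set where the gap is [d], the functions
   [f_i (succ a) - f_i a], [i > 0], extend to [f_i (s x) - f_i x] with
   [f_0 (s x) = f_0 x + d]; divided by [d] they form a system of the same shape
   with exponents [mu_j - mu_0 - 1], uniformly in [d] as soon as [d] is small
   compared to [x^(mu_0 + 1)], which only excludes boundedly many points for each
   [d]. The elements produced by the induction hypothesis stay between the
   extreme values of these differences, so by monotonicity they can be added to
   [f_i a] without leaving the interval up to [f_i (succ a)]. Balancing the two
   cases gives the recursion for [phi]. Compactness of [[a, b]] concludes. *)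

Require Import Defs.
From HB Require Import structures.
From mathcomp Require Import all_boot all_order all_algebra finmap.
From mathcomp Require Import all_classical all_reals all_analysis.
From mathcomp Require Import perm zify ring lra.

Set Implicit Arguments.
Unset Strict Implicit.
Unset Printing Implicit Defensive.

Import Order.TTheory GRing.Theory Num.Theory numFieldNormedType.Exports.

Local Open Scope classical_set_scope.
Local Open Scope ring_scope.

Section OrderedFiniteSets.
Context {disp : Order.disp_t} {T : orderType disp}.
Implicit Types A B : {fset T}.

Lemma fset_ex_max A : A != fset0 ->
  exists2 x, x \in A & {in A, forall y, (y <= x)%O}.
Proof.
case/fset0Pn => x xA; pose x0 : A := [` xA]%fset.
have [y _ yM] := @arg_maxP _ _ A x0 xpredT val isT.
by exists (val y) => [|z zA]; [exact: valP|exact: (yM [` zA]%fset)].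
Qed.

Lemma fset_ex_min A : A != fset0 ->
  exists2 x, x \in A & {in A, forall y, (x <= y)%O}.
Proof.
case/fset0Pn => x xA; pose x0 : A := [` xA]%fset.
have [y _ yM] := @arg_minP _ _ A x0 xpredT val isT.
by exists (val y) => [|z zA]; [exact: valP|exact: (yM [` zA]%fset)].
Qed.

Lemma fset_initial_segment A n : (n <= #|` A|)%N ->
  exists B, [/\ (B `<=` A)%fset, #|` B| = n
    & {in B & A `\` B, forall x y, (x < y)%O}%fset].
Proof.
elim: n => [_|n IH nA]; first by exists fset0; rewrite fsub0set cardfs0.
have [B [BA cB ltB]] := IH (ltnW nA).
have [|x] := @fset_ex_min (A `\` B)%fset.
  by rewrite -cardfs_gt0 cardfsDS // cB subn_gt0.
rewrite inE => /andP[xB xA] xmin; exists (x |` B)%fset; split.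
- by rewrite fsubUset fsub1set xA.
- by rewrite cardfsU1 xB cB.
- move=> y z; rewrite !inE negb_or => /orP[/eqP->|yB] /andP[/andP[zx zB] zA].
    by rewrite lt_neqAle eq_sym zx xmin // inE zB.
  by apply: ltB; rewrite ?inE ?zB.
Qed.

Definition below A x := [fset y in A | (y < x)%O]%fset.

Lemma fset_four_blocks A n : (4 * n <= #|` A|)%N -> exists B B1 B2 B3,
  [/\ (B `<=` A)%fset /\ {in B, forall x, n <= #|` below A x|}%N,
      [/\ B1 `<=` B, B2 `<=` B & B3 `<=` B]%fset,
      [/\ n <= #|` B1|, #|` B2| = n & n <= #|` B3|]%N,
      {in B1 & B2, forall x y, (x < y)%O} & {in B2 & B3, forall x y, (x < y)%O}].
Proof.
move=> nA; have n_le_A : (n <= #|` A|)%N by lia.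
have [B0 [B0A cB0 lt0]] := fset_initial_segment n_le_A.
set B := (A `\` B0)%fset in lt0.
have cB : #|` B| = (#|` A| - n)%N by rewrite cardfsDS ?cB0.
have n_le_B : (n <= #|` B|)%N by rewrite cB; lia.
have [B1 [B1B cB1 lt1]] := fset_initial_segment n_le_B.
set B' := (B `\` B1)%fset in lt1.
have cB' : #|` B'| = (#|` B| - n)%N by rewrite cardfsDS ?cB1.
have n_le_B' : (n <= #|` B'|)%N by rewrite cB' cB; lia.
have [B2 [B2B' cB2 lt2]] := fset_initial_segment n_le_B'.
have B'B : (B' `<=` B)%fset := fsubsetDl _ _.
exists B, B1, B2, (B' `\` B2)%fset; split=> //.
- split=> [|x xB]; first exact: fsubsetDl.
  rewrite -cB0; apply/fsubset_leq_card/fsubsetP => y yB0.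
  by rewrite !inE (fsubsetP B0A) ?lt0.
- by split; [|exact: fsubset_trans B'B|exact: fsubset_trans (fsubsetDl _ _) B'B].
- by split; rewrite ?cB1 // cardfsDS // cB2 cB' cB; lia.
- by move=> x y xB1 /(fsubsetP B2B'); exact: lt1.
Qed.

Definition immediate_successor A (A0 : {fset T}) (succ : T -> T) :=
  {in A0, forall a, [/\ a \in A, succ a \in A, (a < succ a)%O
    & {in A, forall b, (a < b)%O -> (succ a <= b)%O}]}.

Lemma ex_immediate_successor A : exists (A0 : {fset T}) (succ : T -> T),
  immediate_successor A A0 succ /\ (#|` A| <= #|` A0|.+1)%N.
Proof.
have [->|/fset_ex_max[w wA wM]] := eqVneq A fset0.
  by exists fset0, id; rewrite cardfs0; split=> // x; rewrite inE.
exists (A `\ w)%fset.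
have /boolp.choice[succ succP] a : exists b, a \in (A `\ w)%fset ->
    [/\ a \in A, b \in A, (a < b)%O & {in A, forall c, (a < c)%O -> (b <= c)%O}].
  have [|_] := boolP (a \in _); last by exists a.
  rewrite !inE => /andP[aw aA]; pose B := [fset b in A | (a < b)%O]%fset.
  have [|b] := @fset_ex_min B.
    by apply/fset0Pn; exists w; rewrite !inE wA lt_neqAle aw wM.
  rewrite !inE => /andP[bA ab] bmin; exists b; split => // c cA ac.
  by apply: bmin; rewrite !inE cA.
by exists succ; split=> //; rewrite (cardfsD1 w A) wA.
Qed.

Lemma immediate_successorS A A0 A1 succ : {subset A1 <= A0} ->
  immediate_successor A A0 succ -> immediate_successor A A1 succ.
Proof. by move=> A10 succA a /A10 /succA. Qed.

End OrderedFiniteSets.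

Section DisjointFamilies.
Context {I T : choiceType}.

Definition disjoint_on (s : {fset I}) (E : I -> {fset T}) :=
  {in s &, forall i j x, x \in E i -> x \in E j -> i = j}.

Lemma big_bigfcup_disjoint (R : Type) (idx : R) (op : Monoid.com_law idx)
    (s : {fset I}) (E : I -> {fset T}) (f : T -> R) : disjoint_on s E ->
  \big[op/idx]_(x <- (\bigcup_(i <- s) E i)%fset) f x =
  \big[op/idx]_(i <- s) \big[op/idx]_(x <- E i) f x.
Proof.
move=> disj; apply: partition_disjoint_bigfcup => i j si sj.
apply: contraNT; rewrite -fsetI_eq0 => /fset0Pn[x].
by rewrite inE => /andP[xi xj]; apply/eqP/(disj i j si sj x).
Qed.

Lemma sum_card_disjoint_le (s : {fset I}) (E : I -> {fset T}) (S : {fset T}) :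
  disjoint_on s E -> {in s, forall i, (E i `<=` S)%fset} ->
  (\sum_(i <- s) #|` E i| <= #|` S|)%N.
Proof.
move=> disj ES; under eq_bigr do rewrite card_fset_sum1.
rewrite -(big_bigfcup_disjoint _ (fun=> 1%N)) // -card_fset_sum1.
by apply/fsubset_leq_card/bigfcupsP => i si _; exact: ES.
Qed.

End DisjointFamilies.

Section Levels.
Context {T : choiceType} {disp : Order.disp_t} {V : orderType disp}.
Implicit Types (A : {fset T}) (g : T -> V).

Definition level A g v := [fset x in A | g x == v]%fset.

Definition level_rank A g x := #|` [fset v in g @` A | (v <= g x)%O]%fset|.

Lemma card_sum_level A g : #|` A| = (\sum_(v <- (g @` A)%fset) #|` level A g v|)%N.
Proof.
rewrite card_fset_sum1 (partition_big_imfset _ g); apply: eq_bigr => v _.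
by rewrite card_fset_sum1 big_fset.
Qed.

Lemma level_disjoint A g (s : {fset V}) (E : V -> {fset T}) :
  {in s, forall v, (E v `<=` level A g v)%fset} -> disjoint_on s E.
Proof.
move=> EL v w sv sw x /(fsubsetP (EL v sv)) + /(fsubsetP (EL w sw)).
by rewrite !inE => /andP[_ /eqP->] /andP[_ /eqP->].
Qed.

Context {R : realFieldType}.

Lemma card_low_rank_values A g (p : R) : 0 <= p ->
  #|` (g @` [fset x in A | (level_rank A g x)%:R <= p])%fset|%:R <= p.
Proof.
set B := [fset x in A | _]%fset => p0.
have [->|] := eqVneq (g @` B)%fset fset0; first by rewrite cardfs0.
move=> /fset_ex_max[_ /imfsetP[x /= xB ->] xmax].
have := xB; rewrite !inE => /andP[xA]; apply: le_trans; rewrite ler_nat.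
apply/fsubset_leq_card/fsubsetP => v vB; rewrite !inE /= xmax // andbT.
by case/imfsetP: vB => y; rewrite !inE => /andP[yA _] ->; rewrite in_imfset.
Qed.

Lemma card_high_rank_le A g (p : R) :
  p * (#|` A|%:R - #|` [fset x in A | (level_rank A g x)%:R <= p]%fset|%:R)
    <= (\sum_(x <- A) level_rank A g x)%:R.
Proof.
rewrite !card_fset_sum1 big_fset !natr_sum [X in _ - X]big_mkcond /=.
rewrite -sumrB mulr_sumr; apply: ler_sum => x _.
by case: (leP _%:R p) => [_|/ltW]; rewrite ?subrr ?mulr0 // subr0 mulr1.
Qed.

(* At most [p] values are taken at points of rank at most [p], and the levels
   smaller than [u] contribute at most [u] points to each of them. *)
Lemma sum_popular_levels A g (p u : R) : 0 < p -> 0 <= u ->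
  #|` A|%:R - (\sum_(x <- A) level_rank A g x)%:R / p - p * u <=
  (\sum_(v <- (g @` A)%fset | u <= #|` level A g v|%:R) #|` level A g v|)%:R.
Proof.
move=> p0 u0; pose B := [fset x in A | (level_rank A g x)%:R <= p]%fset.
have BA : (B `<=` A)%fset by apply/fsubsetP => x; rewrite !inE => /andP[].
have cB : #|` A|%:R - (\sum_(x <- A) level_rank A g x)%:R / p <= #|` B|%:R :> R.
  have := card_high_rank_le A g p; rewrite -/B -(ler_pdivlMl _ _ p0) mulrC.
  by lra.
have BpA v : #|` level B g v|%:R <=
    (if u <= #|` level A g v|%:R then #|` level A g v|%:R else 0) + u :> R.
  have BAv : (#|` level B g v| <= #|` level A g v|)%N.
    by apply/fsubset_leq_card/fsubsetP => x; rewrite !inE => /andP[/andP[-> _]].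
  case: (leP u _%:R) => h; last by rewrite add0r (le_trans _ (ltW h)) // ler_nat.
  by rewrite -[leLHS]addr0 lerD ?ler_nat.
have gBA : (g @` B `<=` g @` A)%fset.
  by apply/fsubsetP => _ /imfsetP[x /(fsubsetP BA) xA ->]; rewrite in_imfset.
suff : #|` B|%:R <= p * u +
    (\sum_(v <- (g @` A)%fset | u <= #|` level A g v|%:R) #|` level A g v|)%:R :> R.
  by move: cB; lra.
rewrite (card_sum_level B g) natr_sum.
apply: le_trans (ler_sum _ (fun v _ => BpA v)) _.
rewrite big_split [leRHS]addrC lerD //; last first.
  rewrite /= big_const_seq count_predT iter_addr addr0 -mulr_natl.
  by rewrite ler_wpM2r // card_low_rank_values // ltW.
rewrite natr_sum [leRHS]big_mkcond [leRHS](big_fsetIDcond _ (mem (g @` B)%fset)) /=.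
rewrite -[leLHS]addr0 lerD //; last by apply: sumr_ge0 => v _; case: ifP.
rewrite le_eqVlt; apply/orP; left; apply/eqP/eq_fbigl => v.
by rewrite !inE /= andb_idl // => /(fsubsetP gBA).
Qed.

End Levels.

Section Sumdiff.
Context {R : realType}.
Implicit Types (B D : {fset R}) (s t k m : nat) (x y z : R).

Lemma subset_map_fsval B (u : seq R) :
  {subset u <= B} -> exists w : seq B, map (@fsval _ B) w = u.
Proof.
elim: u => [|x u IH] uB; first by exists [::].
have [y yu|w <-] := IH; first by apply: uB; rewrite inE yu orbT.
have xB : x \in B by apply: uB; rewrite inE eqxx.
by exists ([` xB]%fset :: w).
Qed.

Lemma sumdiffP s t B z :
  reflect (exists u v : seq R, [/\ size u = s, size v = t,
      {subset u <= B}, {subset v <= B}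
    & z = \sum_(x <- u) x - \sum_(x <- v) x]) (z \in sumdiff s t B).
Proof.
apply: (iffP idP).
  case/imfset2P => u _ [v _ ->].
  exists (map (@fsval _ B) u), (map (@fsval _ B) v); split.
  - by rewrite size_map size_tuple.
  - by rewrite size_map size_tuple.
  - by move=> x /mapP[y _ ->]; exact: valP.
  - by move=> x /mapP[y _ ->]; exact: valP.
  - by rewrite !big_map !big_tuple.
case=> u [v [<- <- /subset_map_fsval[u' <-] /subset_map_fsval[v' <-] ->]].
apply/imfset2P.
exists (tcast (esym (size_map _ _)) (in_tuple u')) => //.
exists (tcast (esym (size_map _ _)) (in_tuple v')) => //.
by rewrite -!(big_tuple _ _ _ xpredT) !val_tcast !big_map.
Qed.

Lemma sumdiffS s t B B' : (B `<=` B')%fset ->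
  (sumdiff s t B `<=` sumdiff s t B')%fset.
Proof.
move=> /fsubsetP BB'; apply/fsubsetP => z /sumdiffP[u [v [su sv uB vB ->]]].
by apply/sumdiffP; exists u, v; split => // x /[dup] => [/uB|/vB] /BB'.
Qed.

Lemma sumdiff00 B : 0 \in sumdiff 0 0 B.
Proof. by apply/sumdiffP; exists [::], [::]; rewrite !big_nil subrr. Qed.

Lemma sumdiffD s t s' t' B x y : x \in sumdiff s t B -> y \in sumdiff s' t' B ->
  x + y \in sumdiff (s + s') (t + t') B.
Proof.
move=> /sumdiffP[u [v [<- <- uB vB ->]]] /sumdiffP[u' [v' [<- <- u'B v'B ->]]].
apply/sumdiffP; exists (u ++ u'), (v ++ v').
rewrite !size_cat !big_cat /= opprD addrACA; split => // z; rewrite mem_cat.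
- by move=> /orP[/uB|/u'B].
- by move=> /orP[/vB|/v'B].
Qed.

Lemma sumdiffN s t B x : x \in sumdiff s t B -> - x \in sumdiff t s B.
Proof.
move=> /sumdiffP[u [v [su sv uB vB ->]]].
by apply/sumdiffP; exists v, u; rewrite opprB.
Qed.

Lemma sumdiff_sum p q B (u : seq R) : {subset u <= sumdiff p q B} ->
  \sum_(x <- u) x \in sumdiff (size u * p) (size u * q) B.
Proof.
elim: u => [_|x u IH uB]; first by rewrite big_nil sumdiff00.
rewrite big_cons !mulSn sumdiffD ?uB ?inE ?eqxx // IH // => y yu.
by rewrite uB // inE yu orbT.
Qed.

Lemma sumdiff_nest s t p q B D z : {subset D <= sumdiff p q B} ->
  z \in sumdiff s t D -> z \in sumdiff (s * p + t * q) (s * q + t * p) B.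
Proof.
move=> DB /sumdiffP[u [v [<- <- uD vD ->]]].
have uB : {subset u <= sumdiff p q B} by move=> x /uD /DB.
have vB : {subset v <= sumdiff p q B} by move=> x /vD /DB.
exact: sumdiffD (sumdiff_sum uB) (sumdiffN (sumdiff_sum vB)).
Qed.

Lemma sumdiff_pad s t k B z : B != fset0 ->
  z \in sumdiff s t B -> z \in sumdiff (s + k) (t + k) B.
Proof.
move=> /fset0Pn[b bB] zB; rewrite -[z]addr0; apply: sumdiffD => //.
have bb : 0 \in sumdiff 1 1 B.
  apply/sumdiffP; exists [:: b], [:: b]; rewrite subrr.
  by split => // x; rewrite inE => /eqP->.
have /sumdiff_sum : {subset nseq k 0 <= sumdiff 1 1 B} by move=> x /nseqP[->].
by rewrite big1_seq ?size_nseq ?muln1 // => x /andP[_ /nseqP[->]].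
Qed.

Lemma sumdiffZ s t a B z : z \in sumdiff s t B ->
  a * z \in sumdiff s t ( *%R a @` B)%fset.
Proof.
move=> /sumdiffP[u [v [su sv uB vB ->]]]; apply/sumdiffP.
exists (map ( *%R a) u), (map ( *%R a) v).
rewrite !size_map mulrBr !big_map !mulr_sumr; split => // _ /mapP[x xuv ->].
- by rewrite in_imfset //; exact: uB.
- by rewrite in_imfset //; exact: vB.
Qed.

Definition between B z := exists b b', [/\ b \in B, b' \in B & b <= z <= b'].

Lemma betweenS B B' z : (B `<=` B')%fset -> between B z -> between B' z.
Proof.
by move=> /fsubsetP BB' [b [b' [/BB' bB /BB' b'B bzb']]]; exists b, b'.
Qed.

Lemma betweenZ a B z : between B z -> between ( *%R a @` B)%fset (a * z).
Proof.
move=> [b [b' [bB b'B /andP[bz zb']]]].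
have [a0|/ltW a0] := leP 0 a.
  by exists (a * b), (a * b'); rewrite !in_imfset // !ler_wpM2l.
by exists (a * b'), (a * b); rewrite !in_imfset // !ler_wnM2l.
Qed.

Definition sumdiff_between m B : {fset R} :=
  [fset z in sumdiff (2 ^ m) (2 ^ m - 1) B | `[< between B z >]]%fset.

Lemma sumdiff_betweenP m B z : reflect
  (z \in sumdiff (2 ^ m) (2 ^ m - 1) B /\ between B z)
  (z \in sumdiff_between m B).
Proof. by rewrite !inE /=; apply: (iffP andP) => -[? /asboolP]. Qed.

Lemma sumdiff_between_sub m B :
  (sumdiff_between m B `<=` sumdiff (2 ^ m) (2 ^ m - 1) B)%fset.
Proof. by apply/fsubsetP => z /sumdiff_betweenP[]. Qed.

Lemma sumdiff_betweenS m B B' : (B `<=` B')%fset ->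
  (sumdiff_between m B `<=` sumdiff_between m B')%fset.
Proof.
move=> BB'; apply/fsubsetP => z /sumdiff_betweenP[zB bz].
apply/sumdiff_betweenP; split; last exact: betweenS bz.
by move: zB; apply/fsubsetP/sumdiffS.
Qed.

Lemma sub_pow2_sumdiff m B : (B `<=` sumdiff (2 ^ m) (2 ^ m - 1) B)%fset.
Proof.
apply/fsubsetP => b bB; rewrite -{1}(@subnKC 1 (2 ^ m)) ?expn_gt0 //.
rewrite -[X in sumdiff _ X](add0n (2 ^ m - 1)%N) sumdiff_pad ?sumdiff10 //.
by apply/fset0Pn; exists b.
Qed.

Lemma sub_sumdiff_between m B : (B `<=` sumdiff_between m B)%fset.
Proof.
apply/fsubsetP => b bB; apply/sumdiff_betweenP; split; last first.
  by exists b, b; rewrite lexx.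
exact: (fsubsetP (sub_pow2_sumdiff m B)).
Qed.

Lemma card_sumdiff_betweenZ m a B : a != 0 ->
  (#|` sumdiff_between m B| <= #|` sumdiff_between m ( *%R a @` B)%fset|)%N.
Proof.
move=> a0; have <- : #|` ( *%R a @` sumdiff_between m B)%fset| =
  #|` sumdiff_between m B| by exact/card_imfset/mulfI.
apply/fsubset_leq_card/fsubsetP => _ /imfsetP[z /sumdiff_betweenP[zB bz] ->].
by apply/sumdiff_betweenP; split; [exact: sumdiffZ|exact: betweenZ].
Qed.

Definition gap (succ g : R -> R) x := g (succ x) - g x.

Lemma gap_sumdiff (A A0 : {fset R}) succ g : immediate_successor A A0 succ ->
  {subset gap succ g @` A0 <= sumdiff 1 1 (g @` A)}%fset.
Proof.
move=> sA _ /imfsetP[x /= /sA[xA sxA _ _] ->]; apply/sumdiffP.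
exists [:: g (succ x)], [:: g x]; rewrite !big_seq1.
by split=> // y; rewrite inE => /eqP->; rewrite in_imfset.
Qed.

(* The translates [g a + E a] lie in the disjoint half-open intervals between
   consecutive values of [g]. *)
Lemma squeezing m (A A0 A1 : {fset R}) (succ g : R -> R) (E : R -> {fset R}) :
  immediate_successor A A0 succ -> (A1 `<=` A0)%fset ->
  {in A &, {homo g : x y / x <= y}} ->
  {in A1, forall a e, e \in E a -> 0 < e <= gap succ g a /\
     e \in sumdiff (2 ^ m) (2 ^ m - 1) (gap succ g @` A0)%fset} ->
  (\sum_(a <- A1) #|` E a| <= #|` sumdiff_between m.+1 (g @` A)%fset|)%N.
Proof.
move=> sA0 /fsubsetP A10 g_homo EP; have sA := immediate_successorS A10 sA0.
rewrite (eq_bigr (fun a => #|` (+%R (g a) @` E a)%fset|)); last first.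
  by move=> a _; apply/esym/card_imfset/addrI.
apply: sum_card_disjoint_le => [a b aA1 bA1 z|a aA1]; last first.
  apply/fsubsetP => _ /imfsetP[e /= /(EP a aA1)[/andP[e0 e_le] eS] ->].
  have [aA saA _ _] := sA a aA1; apply/sumdiff_betweenP; split; last first.
    exists (g a), (g (succ a)); rewrite !in_imfset // lerDl (ltW e0); split=> //.
    by rewrite -lerBrDl.
  have gaB : g a \in sumdiff 1 0 (g @` A)%fset by rewrite sumdiff10 in_imfset.
  have := sumdiffD gaB (sumdiff_nest (gap_sumdiff sA0) eS).
  congr (_ \in sumdiff _ _ _); rewrite !muln1 expnS; have := expn_gt0 2 m; lia.
wlog ab : a b aA1 bA1 / a < b.
  move=> lt_case zE zF; have [ab|ba|//] := ltgtP a b; first exact: (lt_case a b).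
  by apply/esym/(lt_case b a).
move=> /imfsetP[e /= /(EP a aA1)[/andP[_ e_le] _] ->].
move=> /imfsetP[e' /= /(EP b bA1)[/andP[e'0 _] _] eq_translate].
have [[_ saA _ s_min] [bA _ _ _]] := (sA a aA1, sA b bA1).
have := g_homo _ _ saA bA (s_min b bA ab); rewrite /gap in e_le; lra.
Qed.

Lemma sum_gap_rank_le m (A A0 : {fset R}) (succ g : R -> R) :
  immediate_successor A A0 succ -> {in A &, {homo g : x y / x < y}} ->
  (\sum_(a <- A0) level_rank A0 (gap succ g) a <=
   #|` sumdiff_between m.+1 (g @` A)%fset|)%N.
Proof.
move=> sA g_homo; apply: (squeezing sA (fsubset_refl _)) => [x y xA yA|a aA0 e].
  by rewrite le_eqVlt => /predU1P[->//|/g_homo/ltW]; exact.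
rewrite !inE => /andP[eG e_le]; split; last first.
  exact: (fsubsetP (sub_pow2_sumdiff _ _)).
rewrite [X in _ && X]e_le andbT; case/imfsetP: eG => b /= /sA[bA sbA bsb _] ->.
by rewrite subr_gt0 g_homo.
Qed.

Lemma sum_level_squeezing m (A A0 D : {fset R}) (succ g h : R -> R)
    (T E : R -> {fset R}) :
  immediate_successor A A0 succ -> {in A &, {homo g : x y / x <= y}} ->
  {in D, forall d, [/\ (T d `<=` level A0 h d)%fset,
     (E d `<=` sumdiff (2 ^ m) (2 ^ m - 1) (gap succ g @` A0))%fset
   & {in T d & E d, forall a e, 0 < e <= gap succ g a}]} ->
  (\sum_(d <- D) #|` T d| * #|` E d| <=
   #|` sumdiff_between m.+1 (g @` A)%fset|)%N.
Proof.
move=> sA g_homo TE; have TL d : d \in D -> (T d `<=` level A0 h d)%fset.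
  by move=> /TE[].
have disj : disjoint_on D T := level_disjoint TL.
have levelP d a : d \in D -> a \in T d -> a \in A0 /\ h a = d.
  by move=> /TL /fsubsetP Td /Td; rewrite !inE => /andP[-> /eqP].
have -> : (\sum_(d <- D) #|` T d| * #|` E d| =
    \sum_(a <- (\bigcup_(d <- D) T d)%fset) #|` E (h a)|)%N.
  rewrite (big_bigfcup_disjoint _ _ disj); apply: eq_big_seq => d dD.
  rewrite card_fset_sum1 big_distrl; apply: eq_big_seq => a /(levelP d a dD)[_ ->].
  exact: mul1n.
apply: (squeezing sA) => //.
  by apply/fsubsetP => a /bigfcupP[d /andP[dD _] /(levelP d a dD)[]].
move=> a /bigfcupP[d /andP[dD _] aT] e; have [_ ->] := levelP d a dD aT.
have [_ /fsubsetP ES le_gap] := TE d dD.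
by move=> eE; split; [exact: le_gap|exact: ES].
Qed.

End Sumdiff.

Section Phi.
Context {R : realType}.
Implicit Types m : nat.

Lemma phi_gt0 m : 0 < phi R m.+1.
Proof.
elim: m => [|m IH]; first exact: ltr01.
by rewrite phiS //= addr_gt0 // divr_gt0 // addr_gt0 // divr_gt0.
Qed.

(* The solution of [u * u `^ phi m.+1 = N], which balances the two cases of the
   growth step; the recursion for [phi] expresses [N * u `^ phi m.+1]. *)
Lemma powR_phiS m (N : R) : 0 < N -> exists u p : R,
  [/\ 0 < u, 0 < p, u * p = N, u `^ phi R m.+1 = p & N `^ phi R m.+2 = N * p].
Proof.
move=> N0; have := phi_gt0 m; set f := phi R m.+1 => f0.
have [f_neq0 f1_neq0] : f != 0 /\ 1 + f != 0 by rewrite !gt_eqF // addr_gt0.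
exists (N `^ (1 / (1 + f))), (N `^ (f / (1 + f))); split; rewrite ?powR_gt0 //.
- rewrite -powRD; last by rewrite (gt_eqF N0) implybT.
  by rewrite -mulrDl divff // powRr1 // ltW.
- by rewrite -powRrM mulrAC mul1r.
- rewrite phiS // [m.+2.-1]/= -/f powRD; last by rewrite (gt_eqF N0) implybT.
  rewrite powRr1 ?ltW //; congr (_ * _ `^ _).
  by field; rewrite f1_neq0 f_neq0.
Qed.

End Phi.

Section Grows.
Context {R : realType}.
Implicit Types (A : {fset R}) (m : nat) (C : R).

Definition grows m C (f : 'I_m.+1 -> R -> R) A := exists i,
  C * #|` A|%:R `^ phi R m.+1 <= #|` sumdiff_between m (f i @` A)%fset|%:R.

Lemma grows_le m C C' (f : 'I_m.+1 -> R -> R) A : C' <= C ->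
  grows C f A -> grows C' f A.
Proof.
by move=> CC' [i iC]; exists i; apply: le_trans iC; rewrite ler_wpM2r ?powR_ge0.
Qed.

Lemma grows_small m C (f : 'I_m.+1 -> R -> R) A :
  C * #|` A|%:R `^ phi R m.+1 <= 1 -> grows C f A.
Proof.
have [->|A0 C1] := eqVneq A fset0.
  by exists ord0; rewrite cardfs0 powR0 ?mulr0 // gt_eqF // phi_gt0.
exists ord0; apply: le_trans C1 _; rewrite ler1n cardfs_gt0.
have /fset0Pn[a aA] := A0; apply/fset0Pn; exists (f ord0 a).
by apply: (fsubsetP (sub_sumdiff_between _ _)); rewrite in_imfset.
Qed.

Lemma growsZ m C (f : 'I_m.+1 -> R -> R) (a : 'I_m.+1 -> R) A :
  (forall i, a i != 0) -> grows C (fun i x => a i * f i x) A -> grows C f A.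
Proof.
move=> a0 [i iC]; exists i; apply: le_trans iC _; rewrite ler_nat.
have ai : (a i)^-1 != 0 by rewrite invr_eq0.
apply: leq_trans (card_sumdiff_betweenZ m _ ai) _.
rewrite -imfset_comp (_ : _ \o _ = f i) //.
by apply/funext => x /=; rewrite mulKf.
Qed.

Lemma grows_imfset m C (f : 'I_m.+1 -> R -> R) (h : R -> R) A :
  {in A &, injective h} -> grows C (fun i => f i \o h) A -> grows C f (h @` A)%fset.
Proof. by move=> h_inj [i]; exists i; rewrite card_in_imfset // -imfset_comp. Qed.

Lemma eq_in_grows m C (f g : 'I_m.+1 -> R -> R) A :
  (forall i, {in A, f i =1 g i}) -> grows C f A -> grows C g A.
Proof.
move=> fg [i iC]; exists i; apply: le_trans iC _.
suff -> : (f i @` A)%fset = (g i @` A)%fset by [].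
by apply: eq_in_imfset => // x; exact: fg.
Qed.

End Grows.

Section LevelGrowth.
Context {R : realType} (m : nat).
Implicit Types (X Y T E : {fset R}) (G : 'I_m.+1 -> R -> R) (h r : nat) (C : R).

Definition monotone_on X (g : R -> R) :=
  {in X &, {homo g : x y / x <= y}} \/ {in X &, {homo g : x y /~ x <= y}}.

Definition monotone_grows_above r C G X := forall Y, (Y `<=` X)%fset ->
  {in Y, forall y, r <= #|` below X y|}%N ->
  (forall i, monotone_on Y (G i)) /\ grows C G Y.

(* The growth is extracted from the third quarter of [X] and then compared with
   the values of [G i] on the second or the last quarter: which one depends on
   the direction of monotonicity of [G i], where [i] is only known afterwards.
   The first quarter is sacrificed to leave enough points below the others. *)
Lemma level_growth r h C G X : (r <= h)%N -> (4 * h <= #|` X|)%N ->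
  (forall i, {in X, forall x, 0 < G i x}) -> monotone_grows_above r C G X ->
  exists i T E, [/\ (T `<=` X)%fset, (h <= #|` T|)%N,
    C * h%:R `^ phi R m.+1 <= #|` E|%:R,
    (E `<=` sumdiff (2 ^ m) (2 ^ m - 1) (G i @` X))%fset
  & {in T & E, forall x e, 0 < e <= G i x}].
Proof.
move=> rh /fset_four_blocks[Z [Y1 [Y2 [Y3 [[ZX Z_below] [Y1Z Y2Z Y3Z]]]]]].
move=> [cY1 cY2 cY3] lt12 lt23 G_gt0 G_grows.
have {}Z_below : {in Z, forall y, r <= #|` below X y|}%N.
  by move=> y /Z_below; exact: leq_trans.
have Y2X := fsubset_trans Y2Z ZX.
have [mono _] := G_grows Z ZX Z_below.
have [y yY2|_ [i iC]] := G_grows Y2 Y2X; first exact/Z_below/(fsubsetP Y2Z).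
pose T := if `[< {in Z &, {homo G i : x y / x <= y}} >] then Y3 else Y1.
have TZ : (T `<=` Z)%fset by rewrite /T; case: ifP.
have Y2T : {in Y2 & T, forall y x, G i y <= G i x}.
  move=> y x yY2 xT; have [yZ xZ] := (fsubsetP Y2Z y yY2, fsubsetP TZ x xT).
  move: xT; rewrite /T; case: ifPn => [/asboolP inc xT|].
    by apply: inc => //; exact/ltW/lt23.
  case: (mono i) => [/asboolP->//|dec _ xT]; apply: dec => //; exact/ltW/lt12.
exists i, T, (sumdiff_between m (G i @` Y2)%fset); split.
- exact: fsubset_trans TZ ZX.
- by rewrite /T; case: ifP.
- by rewrite -cY2.
- apply: fsubset_trans (sumdiff_between_sub _ _) (sumdiffS _ _ _).
  by apply/fsubsetP => _ /imfsetP[y /(fsubsetP Y2X) yX ->]; rewrite in_imfset.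
move=> x e xT /sumdiff_betweenP[_ [_ [_ [/imfsetP[y yY2 ->] /imfsetP[z zY2 ->]]]]].
move=> /andP[ye ez]; rewrite (lt_le_trans _ ye) ?(le_trans ez) ?Y2T //.
exact/G_gt0/(fsubsetP Y2X).
Qed.

End LevelGrowth.

Section GrowthStep.
Context {R : realType} (m r : nat) (C' : R) (C'_gt0 : 0 < C').
Context (A A0 : {fset R}) (succ : R -> R) (F : 'I_m.+2 -> R -> R).
Hypothesis succA : immediate_successor A A0 succ.
Hypothesis cardA0 : (#|` A| <= #|` A0|.+1)%N.
Hypothesis F_inc : forall i, {in A &, {homo F i : x y / x < y}}.

Let f0_gap := gap succ (F ord0).
Let G i := gap succ (F (lift ord0 i)).
Let S i := #|` sumdiff_between m.+1 (F i @` A)%fset|.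

Hypothesis level_grows : forall d, 0 < d ->
  monotone_grows_above r C' G (level A0 f0_gap d).

Let gap_gt0 i a : a \in A0 -> 0 < gap succ (F i) a.
Proof. by move=> /succA[aA saA asa _]; rewrite subr_gt0 F_inc. Qed.

Let f := phi R m.+1.
Let L := level A0 f0_gap.

(* The last condition lets every [e] in [E] be added to [F (lift ord0 i) x] without
   passing the next value of [F (lift ord0 i)]. *)
Let level_extension (v d : R) (i : 'I_m.+1) (T E : {fset R}) :=
  [/\ (T `<=` L d)%fset, #|` L d|%:R / 8 <= #|` T|%:R :> R,
      C' * (v / 8) `^ f <= #|` E|%:R,
      (E `<=` sumdiff (2 ^ m) (2 ^ m - 1) (G i @` A0))%fset
    & {in T & E, forall x e, 0 < e <= G i x}].

Lemma ex_level_extension (v d : R) : 4 * r.+1%:R <= v -> d \in (f0_gap @` A0)%fset ->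
  v <= #|` L d|%:R -> exists i T E, level_extension v d i T E.
Proof.
move=> rv /imfsetP[a /= aA0 da] vL.
have d0 : 0 < d by rewrite da gap_gt0.
have L_large : (4 * r.+1 <= #|` L d|)%N.
  by rewrite -(ler_nat R) natrM; exact: le_trans rv vL.
have LA0 : (L d `<=` A0)%fset by apply/fsubsetP => x; rewrite !inE => /andP[].
have hL : #|` L d|%:R / 8 <= (#|` L d| %/ 4)%N%:R :> R.
  by rewrite ler_pdivrMr // -natrM ler_nat; lia.
have [||i x xL|i [T [E [TL cT cE ES TE]]]] :=
    level_growth _ _ _ (level_grows d0) (h := (#|` L d| %/ 4)%N).
- by lia.
- by rewrite -/(L d); lia.
- by apply: gap_gt0; exact: (fsubsetP LA0).
exists i, T, E; split=> //.
- by apply: le_trans hL _; rewrite ler_nat.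
- apply: le_trans cE; rewrite ler_pM2l // ge0_ler_powR ?nnegrE ?(ltW (phi_gt0 m)) //.
    by rewrite divr_ge0 // (le_trans _ rv) // mulr_ge0.
  by apply: le_trans hL; rewrite ler_pM2r.
- apply: fsubset_trans ES (sumdiffS _ _ _); apply/fsubsetP => _ /imfsetP[x xL ->].
  by rewrite in_imfset //=; exact: (fsubsetP LA0).
Qed.

Lemma popular_levels_growth (v : R) : 4 * r.+1%:R <= v -> exists i,
  C' * (v / 8) `^ f / 8 *
    (\sum_(d <- (f0_gap @` A0)%fset | v <= #|` L d|%:R) #|` L d|)%:R
  <= m.+1%:R * (S (lift ord0 i))%:R.
Proof.
move=> rv; pose P := [fset d in (f0_gap @` A0)%fset | v <= #|` L d|%:R]%fset.
have /boolp.choice[w wP] d : exists w : 'I_m.+1 * ({fset R} * {fset R}),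
    d \in P -> level_extension v d w.1 w.2.1 w.2.2.
  have [|_] := boolP (d \in P); last by exists (ord0, (fset0, fset0)).
  rewrite !inE => /andP[dG vL]; have [i [T [E ext]]] := ex_level_extension rv dG vL.
  by exists (i, (T, E)).
pose idx d := (w d).1; pose T d := (w d).2.1; pose E d := (w d).2.2.
have sum_le i : (\sum_(d <- P | idx d == i) #|` T d| * #|` E d| <= S (lift ord0 i))%N.
  rewrite big_fset_condE.
  apply: (sum_level_squeezing succA (h := f0_gap)) => [x y xA yA|d].
    by rewrite le_eqVlt => /predU1P[->//|/F_inc/ltW]; exact.
  by rewrite inE /= => /andP[dP /eqP <-]; case: (wP d dP).
have [i _ imax] := @arg_maxnP _ ord0 xpredT (S \o lift ord0) isT.
exists i; apply: (@le_trans _ _ (\sum_(d <- P) #|` T d| * #|` E d|)%:R).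
  rewrite big_fset_condE !natr_sum.
  rewrite mulr_sumr big_seq [leRHS]big_seq; apply: ler_sum => d dP.
  have [_ LT CE _ _] := wP d dP; rewrite natrM [leLHS]mulrC [leLHS]mulrA [leLHS]mulrAC.
  by apply: ler_pM; rewrite ?divr_ge0 ?mulr_ge0 ?powR_ge0 ?(ltW C'_gt0).
rewrite -natrM ler_nat (partition_big idx xpredT) //=.
apply: (@leq_trans (\sum_(j < m.+1) S (lift ord0 i))); last first.
  by rewrite sum_nat_const card_ord.
by apply: leq_sum => j _; exact: leq_trans (sum_le j) (imax j isT).
Qed.

Lemma popular_levels_half (u p : R) : 0 <= u -> 0 < p -> u * p = #|` A|%:R ->
  32 <= #|` A|%:R :> R -> (S ord0)%:R < #|` A|%:R * p / 4 ->
  #|` A|%:R / 2 <=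
    (\sum_(d <- (f0_gap @` A0)%fset | u / 8 <= #|` L d|%:R) #|` L d|)%:R :> R.
Proof.
set N : R := #|` A|%:R => u0 p0 upN N32 S0_small.
have N_A0 : N <= #|` A0|%:R + 1 by rewrite natr1 ler_nat.
have rank_le : (\sum_(a <- A0) level_rank A0 f0_gap a)%:R / p <= N / 4.
  rewrite ler_pdivrMr // mulrAC (le_trans _ (ltW S0_small)) // ler_nat.
  exact: sum_gap_rank_le.
have u80 : 0 <= u / 8 by rewrite divr_ge0.
have := sum_popular_levels A0 f0_gap p0 u80; rewrite -/L.
have -> : p * (u / 8) = N / 8 by rewrite -upN; ring.
by move: N_A0 rank_le N32; lra.
Qed.

Lemma growth_step_large (u p : R) : 32 * r.+1%:R <= u -> 0 < p -> u * p = #|` A|%:R ->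
  u `^ phi R m.+1 = p -> #|` A|%:R `^ phi R m.+2 = #|` A|%:R * p ->
  grows (Num.min 4^-1 (C' / (16 * 64 `^ phi R m.+1 * m.+1%:R))) F A.
Proof.
set N : R := #|` A|%:R; set C := Num.min _ _; rewrite -/f => ru p0 upN ufp Nf.
have C4 : C <= 4^-1 by rewrite ge_min lexx.
have [S0_large|S0_small] := leP (N * p / 4) (S ord0)%:R.
  exists ord0; apply: le_trans S0_large.
  by rewrite Nf mulrC ler_wpM2l // mulr_ge0 // ltW.
have r1 : 1 <= r.+1%:R :> R by rewrite ler1n.
have u32 : 32 <= u by apply: le_trans ru; rewrite ler_peMr.
have p1 : 1 <= p.
  have <- : 1 `^ f = 1 :> R by rewrite powR1.
  rewrite -ufp ge0_ler_powR ?nnegrE ?(ltW (phi_gt0 m)) //; lra.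
have N32 : 32 <= N by rewrite -upN -[32]mulr1 ler_pM.
have u0 : 0 <= u by lra.
have half := popular_levels_half u0 p0 upN N32 S0_small.
have [|i PL_le] := popular_levels_growth (v := u / 8); first by lra.
exists (lift ord0 i).
have M0 : 0 < m.+1%:R :> R by rewrite ltr0n.
have f640 : 0 < 64 `^ f :> R by rewrite powR_gt0.
have u64 : (u / 8 / 8) `^ f = p / 64 `^ f.
  rewrite -ufp -mulrA -invfM -natrM powRM ?invr_ge0 //.
  by rewrite -[64^-1]powR_inv1 // -powRrM mulN1r powRN.
rewrite u64 in PL_le; rewrite -(ler_pM2l M0) Nf; apply: le_trans PL_le.
apply: (@le_trans _ _ (m.+1%:R * (C' / (16 * 64 `^ f * m.+1%:R) * (N * p)))).
  rewrite ler_pM2l // ler_wpM2r ?mulr_ge0 ?(ltW p0) //.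
  by rewrite /C ge_min lexx orbT.
have -> : m.+1%:R * (C' / (16 * 64 `^ f * m.+1%:R) * (N * p)) =
    C' * (p / 64 `^ f) / 8 * (N / 2).
  by field; rewrite !gt_eqF.
by rewrite ler_wpM2l // divr_ge0 // mulr_ge0 ?divr_ge0 // ltW.
Qed.

End GrowthStep.

Lemma growth_step (R : realType) m r (C' : R) : 0 < C' -> exists2 C : R, 0 < C &
  forall (A A0 : {fset R}) (succ : R -> R) (F : 'I_m.+2 -> R -> R),
  immediate_successor A A0 succ -> (#|` A| <= #|` A0|.+1)%N ->
  (forall i, {in A &, {homo F i : x y / x < y}}) ->
  (forall d, 0 < d -> monotone_grows_above r C'
     (fun i => gap succ (F (lift ord0 i))) (level A0 (gap succ (F ord0)) d)) ->
  grows C F A.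
Proof.
move=> C'0; set f := phi R m.+1; set f' := phi R m.+2.
have [f0 f'0] : 0 < f /\ 0 < f' := conj (phi_gt0 _) (phi_gt0 _).
pose u0 : R := 32 * r.+1%:R; pose N0 : R := u0 * u0 `^ f.
have u00 : 0 < u0 by rewrite mulr_gt0.
have N00 : 0 < N0 by rewrite mulr_gt0 ?powR_gt0.
pose C1 := (N0 `^ f')^-1; pose C2 := C' / (16 * 64 `^ f * m.+1%:R).
have C10 : 0 < C1 by rewrite invr_gt0 powR_gt0.
have C20 : 0 < C2 by rewrite divr_gt0 // !mulr_gt0 ?powR_gt0.
exists (Num.min C1 (Num.min 4^-1 C2)).
  by rewrite !lt_min C10 C20 invr_gt0 ltr0n.
move=> A A0 succ F sA cA0 F_inc LG.
have [->|A_neq0] := eqVneq A fset0.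
  by apply: grows_small; rewrite cardfs0 powR0 ?mulr0 // gt_eqF.
have N_gt0 : 0 < #|` A|%:R :> R by rewrite ltr0n cardfs_gt0.
have [u [p [up pp upN ufp Nf]]] := powR_phiS m N_gt0.
have [uu0|/ltW u0u] := leP u u0; last first.
  apply: grows_le (growth_step_large C'0 sA cA0 F_inc LG u0u pp upN ufp Nf).
  by rewrite ge_min lexx orbT.
apply: (@grows_le _ _ C1); first by rewrite ge_min lexx.
have N0_neq0 : N0 `^ f' != 0 by rewrite gt_eqF ?powR_gt0.
apply: grows_small; rewrite -[leRHS](mulVf N0_neq0) ler_pM2l //.
rewrite ge0_ler_powR ?nnegrE ?(ltW f'0) ?(ltW N00) // -upN /N0.
apply: ler_pM; rewrite ?(ltW up) ?(ltW pp) //.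
by rewrite -ufp ge0_ler_powR ?nnegrE ?(ltW f0) ?(ltW up) ?(ltW u00).
Qed.

Section NearRight.
Context {R : realType}.

Lemma near_right_ex (P : R -> Prop) :
  (\forall d \near 0^'+, P d) -> exists2 d, 0 < d & P d.
Proof.
move=> nearP; have [d [d0 Pd]] := filter_ex (filterI (nbhs_right_gt 0) nearP).
by exists d.
Qed.

Lemma near_right_interval (P : R -> Prop) : (\forall t \near 0^'+, P t) ->
  \forall eps \near 0^'+, forall t, 0 < t < eps -> P t.
Proof.
rewrite near_withinE => /nbhs_ballP[eps /= eps0 ballP].
apply: filterS (nbhs_right_le eps0) => e e_eps t /andP[t0 te]; apply: ballP => //.
by rewrite /ball /= sub0r normrN gtr0_norm // (lt_le_trans te).
Qed.

Lemma continuous_near_right (V W : normedModType R) (g : V -> W) (c : V) (eps : R) :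
  {for c, continuous g} -> 0 < eps ->
  \forall dl \near 0^'+, forall a, `|a - c| <= dl -> `|g a - g c| <= eps.
Proof.
move=> /cvgrPdist_le /[apply]; rewrite -nbhs_nearE => /nbhs_ballP[r /= r0 gr].
apply: filterS (nbhs_right_lt r0) => dl dlr a adl.
rewrite distrC; apply: gr.
by rewrite -ball_normE /= distrC (le_lt_trans adl).
Qed.

Lemma mul_near_right (c1 c2 eps : R) : 0 < eps ->
  \forall dl \near 0^'+, forall a b, `|a - c1| <= dl -> `|b - c2| <= dl ->
    `|a * b - c1 * c2| <= eps.
Proof.
move=> /(continuous_near_right (@mul_continuous R (c1, c2))).
apply: filterS => dl close a b ac bc; apply: (close (a, b)).
by rewrite prod_normE /= ge_max ac.
Qed.

Lemma exprz_continuous (nu : int) (x : R) : x != 0 ->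
  {for x, continuous (fun t : R => t ^ nu)}.
Proof.
case: nu => n x0; first exact: exprn_continuous.
by apply: cvgV; [rewrite expf_neq0|exact: exprn_continuous].
Qed.

End NearRight.

Section PowerLike.
Context {R : realType}.
Implicit Types (K : set R) (e f h : R -> R) (c dl eps : R) (mu : int) (k : nat).

Definition positive_set K := forall x, K x -> 0 < x.

Definition derivative_on K f f' := forall x : R, K x -> is_derive x 1 f (f' x).

(* [e] behaves like [c x^mu] on [K], together with its first [k] derivatives
   and with relative error [dl]. *)
Fixpoint power_like k K dl c mu e : Prop :=
  (forall x, K x -> `|e x / x ^ mu - c| <= dl) /\
  if k is k'.+1 then
    exists2 e', derivative_on K e e' & power_like k' K dl (c * mu%:~R) (mu - 1) e'
  else True.

Lemma power_like_dist k K dl c mu e x : power_like k K dl c mu e ->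
  K x -> `|e x / x ^ mu - c| <= dl.
Proof. by case: k => [|k] [] + _; exact. Qed.

Lemma power_like_derive k K dl c mu e : power_like k.+1 K dl c mu e ->
  exists2 e', derivative_on K e e' & power_like k K dl (c * mu%:~R) (mu - 1) e'.
Proof. by case. Qed.

Lemma power_likeW k k' K K' dl dl' c mu e : (k' <= k)%N -> K' `<=` K -> dl <= dl' ->
  power_like k K dl c mu e -> power_like k' K' dl' c mu e.
Proof.
move=> + KK' dd; elim: k k' c mu e => [|k IH] [|k'] c mu e //= kk [close der].
- by split=> // x /KK' /close /le_trans; apply.
- by split=> // x /KK' /close /le_trans; apply.
- split=> [x /KK' /close /le_trans|]; first by apply.
  by case: der => e' de like_e'; exists e' => [x /KK'|]; [exact: de|exact: IH].
Qed.

Lemma power_likeD k K dl1 dl2 c1 c2 mu e1 e2 :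
  power_like k K dl1 c1 mu e1 -> power_like k K dl2 c2 mu e2 ->
  power_like k K (dl1 + dl2) (c1 + c2) mu (fun x => e1 x + e2 x).
Proof.
have dist d d' c c' x a a' : `|a / x - c| <= d -> `|a' / x - c'| <= d' ->
    `|(a + a') / x - (c + c')| <= d + d'.
  by move=> ? ?; rewrite mulrDl opprD addrACA (le_trans (ler_normD _ _)) ?lerD.
elim: k c1 c2 mu e1 e2 => [|k IH] c1 c2 mu e1 e2 /= [close1 der1] [close2 der2];
  split=> //.
- by move=> x Kx; apply: dist; [exact: close1|exact: close2].
- by move=> x Kx; apply: dist; [exact: close1|exact: close2].
case: der1 der2 => [e1' de1 like_e1'] [e2' de2 like_e2'].
exists (fun x => e1' x + e2' x) => [x Kx|]; last by rewrite mulrDl; exact: IH.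
by apply: is_deriveD; [exact: de1|exact: de2].
Qed.

Lemma power_likeZ k K a dl c mu e : power_like k K dl c mu e ->
  power_like k K (`|a| * dl) (a * c) mu (fun x => a * e x).
Proof.
elim: k c mu e => [|k IH] c mu e /= [close der]; split=> //.
- by move=> x Kx; rewrite -mulrA -mulrBr normrM ler_wpM2l ?close.
- by move=> x Kx; rewrite -mulrA -mulrBr normrM ler_wpM2l ?close.
case: der => e' de like_e'; exists (fun x => a * e' x) => [x Kx|].
  exact: (@is_deriveZ _ _ _ e a x 1 (e' x) (de x Kx)).
by rewrite -mulrA; exact: IH.
Qed.

Lemma power_like_mul k c1 c2 mu1 mu2 eps : 0 < eps ->
  \forall dl \near 0^'+, forall K e1 e2, positive_set K ->
    power_like k K dl c1 mu1 e1 -> power_like k K dl c2 mu2 e2 ->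
    power_like k K eps (c1 * c2) (mu1 + mu2) (fun x => e1 x * e2 x).
Proof.
have split_quotient (x a b : R) nu1 nu2 : 0 < x ->
    a * b / x ^ (nu1 + nu2) = (a / x ^ nu1) * (b / x ^ nu2).
  by move=> x0; rewrite expfzDr ?gt_eqF // invfM mulrACA.
elim: k c1 c2 mu1 mu2 eps => [|k IH] c1 c2 mu1 mu2 eps eps0.
  apply: filterS (mul_near_right c1 c2 eps0) => dl close_mul K e1 e2 K0.
  move=> [close1 _] [close2 _].
  by split=> // x Kx; rewrite split_quotient ?K0 // close_mul ?close1 ?close2.
have eps2 : 0 < eps / 2 by rewrite divr_gt0.
apply: filterS3 (mul_near_right c1 c2 eps0)
  (IH (c1 * mu1%:~R) c2 (mu1 - 1) mu2 _ eps2)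
  (IH c1 (c2 * mu2%:~R) mu1 (mu2 - 1) _ eps2).
move=> dl close_mul like_e1'e2 like_e1e2' K e1 e2 K0 like1 like2.
case: (like1) (like2) => close1 [e1' de1 like_e1'] [close2 [e2' de2 like_e2']]; split.
  by move=> x Kx; rewrite split_quotient ?K0 // close_mul ?close1 ?close2.
exists (fun x => e1' x * e2 x + e1 x * e2' x) => [x Kx|].
  apply: is_derive_eq (is_deriveM (de1 x Kx) (de2 x Kx)) _.
  by rewrite /GRing.scale /=; ring.
have -> : c1 * c2 * (mu1 + mu2)%:~R = c1 * mu1%:~R * c2 + c1 * (c2 * mu2%:~R).
  by rewrite intrD; ring.
rewrite (splitr eps); apply: power_likeD.
  rewrite addrAC; apply: like_e1'e2 => //; exact: power_likeW like2.
by rewrite -addrA; apply: like_e1e2' => //; exact: power_likeW like1.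
Qed.

Lemma power_like_neq0 k K dl c mu e x : dl < `|c| -> power_like k K dl c mu e ->
  K x -> e x != 0.
Proof.
move=> dlc /power_like_dist close /close; apply: contraTneq => ->.
by rewrite mul0r sub0r normrN -ltNge.
Qed.

Lemma power_like_inv k c mu eps : c != 0 -> 0 < eps ->
  \forall dl \near 0^'+, forall K e, positive_set K -> power_like k K dl c mu e ->
    (forall x, K x -> e x != 0) /\
    power_like k K eps c^-1 (- mu) (fun x => (e x)^-1).
Proof.
move=> c0; have nc0 : 0 < `|c| by rewrite normr_gt0.
elim: k eps => [|k IH] eps eps0;
  have inv_near := continuous_near_right (inv_continuous c0) eps0.
  apply: filterS2 inv_near (nbhs_right_lt nc0) => dl close_inv dlc K e K0 like_e.
  split=> [x|]; first exact: power_like_neq0 dlc like_e.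
  by split=> // x Kx; rewrite -invr_expz -invfM close_inv // (power_like_dist like_e).
have /near_right_ex[dl1 dl1_gt0 like_e'ee] :=
  power_like_mul k (- (c * mu%:~R)) (c^-1 * c^-1) (mu - 1) (- mu - mu) eps0.
have /near_right_ex[dl2 dl2_gt0 like_ee] :=
  power_like_mul k c^-1 c^-1 (- mu) (- mu) dl1_gt0.
have dlc0 : 0 < Num.min dl1 `|c| by rewrite lt_min dl1_gt0.
apply: filterS3 inv_near (IH dl2 dl2_gt0) (nbhs_right_lt dlc0) => dl close_inv IHdl.
rewrite lt_min => /andP[dl_dl1 dlc] K e K0 like_e.
case: (like_e) => close [e' de like_e'].
have [|e_neq0 like_inv] := IHdl K e K0; first exact: power_likeW like_e.
split=> //; split=> [x Kx|]; first by rewrite -invr_expz -invfM close_inv // close.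
exists (fun x => -1 * e' x * ((e x)^-1 * (e x)^-1)) => [x Kx|].
  apply: is_derive_eq (is_deriveV (e_neq0 x Kx) (de x Kx)) _.
  by rewrite /GRing.scale /= expr2 invfM; ring.
have -> : c^-1 * (- mu)%:~R = - (c * mu%:~R) * (c^-1 * c^-1).
  by rewrite mulrNz; field.
have -> : (- mu - 1 = mu - 1 + (- mu - mu))%R by ring.
apply: like_e'ee => //; last exact: like_ee.
have := power_likeZ (-1) like_e'; rewrite normrN1 mul1r mulN1r.
by apply: power_likeW => //; exact: ltW.
Qed.

Lemma power_like_div k c1 c2 mu1 mu2 eps : c2 != 0 -> 0 < eps ->
  \forall dl \near 0^'+, forall K e1 e2, positive_set K ->
    power_like k K dl c1 mu1 e1 -> power_like k K dl c2 mu2 e2 ->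
    (forall x, K x -> e2 x != 0) /\
    power_like k K eps (c1 / c2) (mu1 - mu2) (fun x => e1 x / e2 x).
Proof.
move=> c20 eps0.
have /near_right_ex[d d0 like_mul] := power_like_mul k c1 c2^-1 mu1 (- mu2) eps0.
apply: filterS2 (power_like_inv k mu2 c20 d0) (nbhs_right_le d0).
move=> dl like_inv dld K e1 e2 K0 like1 like2.
have [e2_neq0 like_inv2] := like_inv K e2 K0 like2.
by split=> //; apply: like_mul => //; exact: power_likeW like1.
Qed.

Lemma power_like_sum n (a c : 'I_n -> R) (mu : 'I_n -> int) (i0 : 'I_n) eps :
  a i0 != 0 -> (forall j, a j != 0 -> j != i0 -> mu i0 < mu j) -> 0 < eps ->
  \forall dl \near 0^'+, forall K (e : 'I_n -> R -> R),
    (forall x, K x -> 0 < x < dl) ->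
    (forall j, power_like 0 K dl (c j) (mu j) (e j)) ->
    power_like 0 K eps (a i0 * c i0) (mu i0) (fun x => \sum_j a j * e j x).
Proof.
move=> ai0 mu_min eps0; pose B := 1 + \sum_j `|a j| * (1 + `|c j|).
have B0 : 0 < B by rewrite ltr_pwDl // sumr_ge0 // => j _; rewrite mulr_ge0 ?addr_ge0.
apply: filterS2 (nbhs_right_le ltr01) (nbhs_right_le (divr_gt0 eps0 B0)).
move=> dl dl1 dl_eps K e Kdl eP; split=> // x Kx; have /andP[x0 xdl] := Kdl x Kx.
have x1 : x <= 1 := le_trans (ltW xdl) dl1.
have term j : `|a j * e j x / x ^ mu i0 - (if j == i0 then a i0 * c i0 else 0)|
    <= `|a j| * (1 + `|c j|) * dl.
  have ej_close := power_like_dist (eP j) Kx.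
  have dl0 : 0 <= dl := le_trans (normr_ge0 _) ej_close.
  case: eqVneq => [->|ji0].
    rewrite -!mulrA -mulrBr normrM ler_wpM2l //.
    by rewrite (le_trans (power_like_dist (eP i0) Kx)) // ler_peMl // lerDl.
  have [->|aj0] := eqVneq (a j) 0; first by rewrite !mul0r subrr normr0 !mul0r.
  have mu_lt := mu_min j aj0 ji0.
  have -> : a j * e j x / x ^ mu i0 = a j * (e j x / x ^ mu j * x ^ (mu j - mu i0)).
    by rewrite expfzDr ?gt_eqF // invr_expz; field; rewrite expfz_neq0 ?gt_eqF.
  rewrite subr0 normrM -[leRHS]mulrA ler_wpM2l // normrM ler_pM //.
    rewrite -(subrK (c j) (e j x / _)) (le_trans (ler_normD _ _)) // lerD2r.
    exact: le_trans ej_close dl1.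
  have -> : (mu j - mu i0)%R = (absz (mu j - mu i0 - 1)%R).+1%:Z by lia.
  rewrite ger0_norm ?exprn_ge0 ?(ltW x0) // -exprnP exprS (le_trans _ (ltW xdl)) //.
  by rewrite ler_piMr ?exprn_ile1 ?(ltW x0).
have -> : (\sum_j a j * e j x) / x ^ mu i0 - a i0 * c i0 =
    \sum_j (a j * e j x / x ^ mu i0 - (if j == i0 then a i0 * c i0 else 0)).
  by rewrite sumrB mulr_suml -big_mkcond big_pred1_eq.
rewrite (le_trans (ler_norm_sum _ _ _)) //.
apply: (le_trans (ler_sum _ (fun j _ => term j))).
rewrite -mulr_suml; apply: (@le_trans _ _ (B * dl)).
  by rewrite ler_wpM2r ?lerDr // ltW // (lt_trans x0).
by rewrite mulrC -ler_pdivlMr.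
Qed.

Lemma power_like_sign K dl c mu e : positive_set K -> dl < `|c| ->
  power_like 0 K dl c mu e -> forall x, K x -> 0 < Num.sg c * e x.
Proof.
move=> K0 dlc like_e x Kx; have x_mu : 0 < x ^ mu by rewrite exprz_gt0 ?K0.
rewrite -(pmulr_lgt0 _ (_ : 0 < (x ^ mu)^-1)) ?invr_gt0 // -mulrA.
have := le_lt_trans (power_like_dist like_e Kx) dlc.
move: (e x / _) => y; rewrite ltr_norml; have [c0|c0|<-] := ltgtP 0 c.
- by rewrite gtr0_sg // gtr0_norm // mul1r => /andP[]; lra.
- by rewrite ltr0_sg // ltr0_norm // mulN1r => /andP[_]; lra.
- by rewrite normr0; lra.
Qed.

Lemma power_like_bounds K dl c mu e : positive_set K -> (forall x, K x -> 0 < e x) ->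
  dl <= `|c| / 2 -> power_like 0 K dl c mu e ->
  forall x, K x -> `|c| / 2 * x ^ mu <= e x <= 2 * `|c| * x ^ mu.
Proof.
move=> K0 e0 dlc like_e x Kx; have x_mu : 0 < x ^ mu by rewrite exprz_gt0 ?K0.
rewrite -ler_pdivlMr // -[X in _ && X]ler_pdivrMr //.
have y0 : 0 < e x / x ^ mu by rewrite divr_gt0 ?e0.
have := le_trans (power_like_dist like_e Kx) dlc.
rewrite ler_norml; move: (e x / _) y0 => y y0.
have [c0|c0] := leP 0 c.
  by rewrite ger0_norm // => /andP[? ?]; apply/andP; split; lra.
by rewrite ltr0_norm // => /andP[? ?]; apply/andP; split; lra.
Qed.

End PowerLike.

Section IntervalCalculus.
Context {R : realType} (K : set R) (f f' : R -> R).
Hypotheses (itvK : is_interval K) (df : derivative_on K f f').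
Implicit Types x y z : R.

Lemma interval_oo x y z : K x -> K y -> z \in `]x, y[ -> K z.
Proof.
move=> Kx Ky; rewrite in_itv /= => /andP[xz zy].
by apply: (itvK Kx Ky); rewrite !ltW.
Qed.

Lemma derivative_on_continuous x : K x -> {for x, continuous f}.
Proof.
by move=> /df[df' _]; apply/differentiable_continuous/derivable1_diffP.
Qed.

Lemma derivative_on_within_continuous x y : K x -> K y ->
  {within `[x, y], continuous f}.
Proof.
move=> Kx Ky; apply: derivable_within_continuous => z.
by rewrite in_itv /= => zxy; have [] := df (itvK Kx Ky zxy).
Qed.

Lemma MVT_on x y : K x -> K y -> x < y ->
  exists2 z, K z /\ x < z < y & f y - f x = f' z * (y - x).
Proof.
move=> Kx Ky xy; have dxy z : z \in `]x, y[ -> is_derive z 1 f (f' z).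
  by move=> zxy; exact/df/(interval_oo Kx Ky).
have [z zxy mvt] := MVT xy dxy (derivative_on_within_continuous Kx Ky).
by exists z => //; split; [exact: interval_oo zxy|move: zxy; rewrite in_itv].
Qed.

Lemma IVT_on x y (v : R) : K x -> K y -> x <= y -> f x <= v <= f y ->
  exists2 z, K z & f z = v.
Proof.
move=> Kx Ky xy /andP[xv vy].
have [|z] := IVT xy (derivative_on_within_continuous Kx Ky) (v := v).
  by rewrite ge_min xv /= le_max vy orbT.
by rewrite in_itv /= => zxy fz; exists z => //; exact: itvK zxy.
Qed.

Hypothesis f'_gt0 : forall x, K x -> 0 < f' x.

Lemma derivative_pos_lt x y : K x -> K y -> (f x < f y) = (x < y).
Proof.
have inc u v : K u -> K v -> u < v -> f u < f v.
  move=> Ku Kv uv; have [z [Kz _] mvt] := MVT_on Ku Kv uv.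
  by rewrite -subr_gt0 mvt mulr_gt0 ?subr_gt0 // f'_gt0.
move=> Kx Ky; have [xy|yx|->] := ltgtP x y; last exact: ltxx.
  exact: inc.
by apply/negbTE; rewrite -leNgt ltW // inc.
Qed.

Lemma derivative_pos_le x y : K x -> K y -> (f x <= f y) = (x <= y).
Proof. by move=> Kx Ky; rewrite !leNgt derivative_pos_lt. Qed.

Lemma derivative_pos_inj x y : K x -> K y -> f x = f y -> x = y.
Proof.
move=> Kx Ky fxy; apply/eqP; rewrite eq_le.
by rewrite -derivative_pos_le // -[y <= x]derivative_pos_le // fxy lexx.
Qed.

Lemma derivative_pos_inverse : open K -> exists g : R -> R,
  (forall y, K y -> g (f y) = y) /\
  (forall y, K y -> is_derive (f y) 1 g (f' y)^-1).
Proof.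
move=> openK; have /boolp.choice[g gP] : forall v : R, exists y,
    (exists2 z, K z & f z = v) -> K y /\ f y = v.
  move=> v; have [[z Kz fz]|no] := pselect (exists2 z, K z & f z = v).
    by exists z.
  by exists 0.
have gK y : K y -> g (f y) = y.
  move=> Ky; have [|Kg fg] := gP (f y); first by exists y.
  exact: derivative_pos_inj.
exists g; split=> // y Ky.
have nearK : \forall z \near y, K z by apply: open_nbhs_nbhs.
apply: (is_derive_inverse _ _ (df Ky)); last by rewrite gt_eqF // f'_gt0.
  exact: filterS nearK.
by apply: filterS nearK => z; exact: derivative_on_continuous.
Qed.

End IntervalCalculus.

Section Shift.
Context {R : realType}.
Implicit Types (K : set R) (f e s h : R -> R) (c dl d eps : R).

Definition shift_dom K f d : set R := [set x | K x /\ exists2 y, K y & f y = f x + d].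

Definition shift_near K K' dl f e d s := K' `<=` K /\
  forall x, K' x -> [/\ K (s x), x < s x <= (1 + dl) * x, f (s x) = f x + d
                      & is_derive x 1 s (e x / e (s x))].

Lemma shift_nearW K K' dl dl' f e d s : positive_set K -> dl <= dl' ->
  shift_near K K' dl f e d s -> shift_near K K' dl' f e d s.
Proof.
move=> K0 dd' [K'K sP]; split=> // x K'x; have [Ks /andP[xs s_le] fs ds] := sP x K'x.
split=> //; rewrite xs (le_trans s_le) // ler_wpM2r ?lerD2l // ltW // K0 //.
exact: K'K.
Qed.

Section ShiftDomain.
Context (K : set R) (f e : R -> R) (d : R).
Hypotheses (openK : open K) (itvK : is_interval K) (d_gt0 : 0 < d).
Hypotheses (df : derivative_on K f e) (e_gt0 : forall x, K x -> 0 < e x).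

Lemma shift_dom_open : open (shift_dom K f d).
Proof.
rewrite openE => x [Kx [y Ky fy]].
have /nbhs_ballP[r /= r0 yr] : nbhs y K by apply: open_nbhs_nbhs.
have Kz : K (y + r / 2).
  apply: yr; rewrite /ball /= opprD addrA subrr add0r normrN gtr0_norm ?divr_gt0 //.
  by rewrite ltr_pdivrMr //; lra.
have fyz : f x + d < f (y + r / 2).
  by rewrite -fy (derivative_pos_lt itvK df e_gt0) // ltrDl divr_gt0.
have /cvgrPdist_lt/(_ (f (y + r / 2) - (f x + d))) := derivative_on_continuous df Kx.
rewrite subr_gt0 => /(_ fyz) near_fx; have nearK : nbhs x K by apply: open_nbhs_nbhs.
apply: filterS2 near_fx nearK => w; rewrite ltr_norml => /andP[lw _] Kw.
split=> //; apply: (IVT_on itvK df Kw Kz); last by move: lw d_gt0 fyz; lra.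
by rewrite -(derivative_pos_le itvK df e_gt0) //; move: lw d_gt0; lra.
Qed.

Lemma shift_dom_interval : is_interval (shift_dom K f d).
Proof.
move=> x y [Kx [x' Kx' fx']] [Ky [y' Ky' fy']] z /[dup] xzy /andP[xz zy].
have Kz := itvK Kx Ky xzy; split=> //.
have fle := derivative_pos_le itvK df e_gt0.
apply: (IVT_on itvK df Kx' Ky'); last by rewrite fx' fy' !lerD2r !fle.
by rewrite -fle // fx' fy' lerD2r fle // (le_trans xz).
Qed.

Lemma ex_shift : exists s : R -> R, forall x, shift_dom K f d x ->
  [/\ K (s x), x < s x, f (s x) = f x + d & is_derive x 1 s (e x / e (s x))].
Proof.
have [g [gK dg]] := derivative_pos_inverse itvK df e_gt0 openK.
exists (fun x => g (f x + d)) => x [Kx [y Ky fy]]; rewrite -fy gK //.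
split=> //; first by rewrite -(derivative_pos_lt itvK df e_gt0) // fy ltrDl.
have dfd : is_derive x 1 (f + cst d) (e x).
  by apply: is_derive_eq (is_deriveD (df Kx) (is_derive_cst d x 1)) _; rewrite addr0.
have := dg y Ky; rewrite fy mulrC => dgy.
exact: (@is_derive1_comp _ g (f + cst d) x _ _ dgy dfd).
Qed.

Lemma shift_close (mu : nat) c dl x y : positive_set K -> 0 < c ->
  (forall z, K z -> c * z ^+ mu <= e z) -> 0 < dl -> K x -> K y ->
  f y = f x + d -> d < c * dl * x ^+ mu.+1 -> y <= (1 + dl) * x.
Proof.
move=> K0 c0 ce dl0 Kx Ky fy d_lt; have x0 := K0 x Kx.
rewrite leNgt; apply/negP => xy; set z := (1 + dl) * x in xy.
have zE : z = x + dl * x by rewrite /z mulrDl mul1r.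
have xz : x < z by rewrite zE ltrDl mulr_gt0.
have Kz : K z by apply: (itvK Kx Ky); rewrite !ltW.
have [t [Kt /andP[xt _]] mvt] := MVT_on itvK df Kx Kz xz.
have et : c * x ^+ mu <= e t.
  apply: le_trans (ce t Kt); rewrite ler_wpM2l ?(ltW c0) //.
  by rewrite lerXn2r ?nnegrE ?ltW // (lt_trans x0).
have : c * x ^+ mu * (dl * x) <= e t * (z - x).
  by rewrite zE [x + _]addrC addrK ler_wpM2r // mulr_ge0 // ltW.
have -> : c * x ^+ mu * (dl * x) = c * dl * x ^+ mu.+1 by rewrite exprS; ring.
have : f z < f y by rewrite (derivative_pos_lt itvK df e_gt0).
by rewrite -mvt fy; lra.
Qed.

End ShiftDomain.

Lemma separated_card_le f d (Z : {fset R}) y : Z != fset0 ->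
  {in Z, forall z, z < y /\ f z + d <= f y} ->
  {in Z &, forall z w, z < w -> f z + d <= f w} ->
  exists2 z, z \in Z & f z + #|` Z|%:R * d <= f y.
Proof.
elim: {Z}_.+1 {-2}Z y (ltnSn #|` Z|) => // n IH Z y + Z0 Zy sepZ.
have [w wZ wM] := fset_ex_max Z0; rewrite (cardfsD1 w) wZ ltnS => cZ.
have [_ w_y] := Zy w wZ; have subZ : {subset (Z `\ w)%fset <= Z}.
  by move=> z; rewrite inE => /andP[].
have [Zw|Zw] := eqVneq (Z `\ w)%fset fset0.
  by exists w => //; rewrite Zw cardfs0 addn0 mul1r.
have zw z : z \in (Z `\ w)%fset -> z < w.
  by move=> /[dup] /subZ /wM zw; rewrite !inE lt_neqAle zw => /andP[->].
have [|z zZ|z v /subZ zZ /subZ vZ|z zZ zle] := IH (Z `\ w)%fset w _ Zw.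
- by rewrite cZ.
- by split; [exact: zw|exact: sepZ (subZ z zZ) wZ (zw z zZ)].
- exact: sepZ.
by exists z; [exact: subZ|rewrite natrD mulrDl mul1r; lra].
Qed.

Lemma separated_rank_le K f e (mu : nat) c d (X : {fset R}) (r : nat) y :
  is_interval K -> positive_set K -> derivative_on K f e -> 0 < c -> 0 <= d ->
  (forall x, K x -> e x <= c * x ^+ mu) -> {in X, forall x, K x} ->
  {in X &, forall z w, z < w -> f z + d <= f w} ->
  y \in X -> (r <= #|` below X y|)%N ->
  r%:R * d <= c * y ^+ mu.+1.
Proof.
move=> itvK K0 df c0 d0 ec XK sepX yX; set Z := below X y => rZ.
have Ky := XK y yX; have y0 := K0 y Ky.
have ZX z : z \in Z -> z \in X /\ z < y by rewrite !inE => /andP[].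
have {rZ} rZ : r%:R * d <= #|` Z|%:R * d by rewrite ler_wpM2r // ler_nat.
apply: le_trans rZ _; have [->|Z0] := eqVneq Z fset0.
  by rewrite cardfs0 mul0r mulr_ge0 ?exprn_ge0 // ltW.
have [z /ZX[zX zy]|z w /ZX[zX _] /ZX[wX _]|z /ZX[zX zy] z_le] :=
    @separated_card_le f d Z y Z0.
- by split=> //; exact: sepX.
- exact: sepX.
have [Kz z0] := (XK z zX, K0 z (XK z zX)).
have [t [Kt /andP[zt ty]] mvt] := MVT_on itvK df Kz Ky zy.
apply: (@le_trans _ _ (f y - f z)); first by rewrite lerBrDl.
rewrite mvt exprSr mulrA; apply: (@le_trans _ _ (c * y ^+ mu * (y - z))).
  rewrite ler_wpM2r ?subr_ge0 ?(ltW zy) // (le_trans (ec t Kt)) //.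
  by rewrite ler_wpM2l ?(ltW c0) // lerXn2r ?nnegrE ?ltW // K0.
by rewrite ler_wpM2l ?mulr_ge0 ?exprn_ge0 ?(ltW c0) ?(ltW y0) // gerBl ltW.
Qed.

End Shift.

Section DifferenceQuotients.
Context {R : realType}.
Implicit Types (K : set R) (f e s h : R -> R) (c dl d eps : R) (mu nu : int).

Definition diff_quotient s d h x := (h (s x) - h x) / d.

Lemma derivative_on_diff_quotient K K' dl f e d s h h' :
  shift_near K K' dl f e d s -> derivative_on K h h' -> (forall x, K x -> e x != 0) ->
  derivative_on K' (diff_quotient s d h)
    (fun x => e x * diff_quotient s d (fun y => h' y / e y) x).
Proof.
move=> [K'K sP] dh e_neq0 x K'x; have Kx := K'K x K'x; have [Ks _ _ ds] := sP x K'x.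
have := is_deriveZ d^-1 (is_deriveB (is_derive1_comp (dh (s x) Ks) ds) (dh x Kx)).
rewrite (_ : _ \*: _ = diff_quotient s d h); last first.
  by apply/funext => y; rewrite /diff_quotient /= /GRing.scale /= mulrC.
move=> der; apply: is_derive_eq der _; rewrite /GRing.scale /= /diff_quotient.
have [n0 ns0] := (e_neq0 x Kx, e_neq0 _ Ks).
by rewrite mulrC [RHS]mulrA; congr (_ / d); field; rewrite n0 ns0.
Qed.

(* By Cauchy's mean value theorem the difference quotient is [h' z / e z] for
   some [z] between [x] and [s x]. *)
Lemma diff_quotient_close c nu eps : 0 < eps ->
  \forall dl \near 0^'+, forall K K' f e s d h h',
    positive_set K -> is_interval K -> derivative_on K f e -> derivative_on K h h' ->
    (forall x, K x -> e x != 0) -> shift_near K K' dl f e d s ->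
    (forall x, K x -> `|h' x / e x / x ^ nu - c| <= dl) ->
    forall x, K' x -> `|diff_quotient s d h x / x ^ nu - c| <= eps.
Proof.
move=> eps0; have /near_right_ex[d1 d10 mul_close] := mul_near_right c 1 eps0.
have pow_near := continuous_near_right (exprz_continuous (nu := nu) (oner_neq0 R)) d10.
apply: filterS2 pow_near (nbhs_right_le d10) => dl pow_close dl_le.
move=> K K' f e s d h h' K0 itvK df dh e0 [K'K sP] quot_close x K'x.
have Kx := K'K x K'x; have x0 := K0 x Kx.
have [Ks /andP[xs s_le] fs _] := sP x K'x.
have Kxs z : z \in `]x, s x[ -> K z := interval_oo itvK Kx Ks.
have [z zxs mvt] := cauchy_MVT xs
  (derivative_on_within_continuous itvK dh Kx Ks)
  (derivative_on_within_continuous itvK df Kx Ks)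
  (fun z zx => dh z (Kxs z zx)) (fun z zx => df z (Kxs z zx))
  (fun z zx => e0 z (Kxs z zx)).
have Kz := Kxs z zxs; have z0 := K0 z Kz.
move: zxs; rewrite in_itv /= => /andP[xz zs].
have -> : diff_quotient s d h x / x ^ nu = h' z / e z / z ^ nu * (z / x) ^ nu.
  rewrite mvt fs [f x + d]addrC addrK -/(diff_quotient s d h x) expfzMl exprz_inv.
  by rewrite -invr_expz; field; rewrite !expfz_neq0 ?gt_eqF.
rewrite -[c]mulr1; apply: mul_close; first exact: le_trans (quot_close z Kz) dl_le.
rewrite -[X in _ - X](exp1rz R nu); apply: pow_close.
rewrite ger0_norm; last by rewrite subr_ge0 ler_pdivlMr // mul1r ltW.
by rewrite lerBlDr addrC ler_pdivrMr // (le_trans (ltW zs)).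
Qed.

Definition diff_quotient_power_like k := forall c0 mu0 c mu eps, c0 != 0 -> 0 < eps ->
  \forall dl \near 0^'+, forall K K' f e s d h,
    positive_set K -> is_interval K -> derivative_on K f e ->
    power_like k K dl c0 mu0 e -> shift_near K K' dl f e d s ->
    power_like k.+1 K dl c mu h ->
    power_like k K' eps (c * mu%:~R / c0) (mu - 1 - mu0) (diff_quotient s d h).

Lemma power_like_mul_diff_quotient k : diff_quotient_power_like k ->
  forall c0 mu0 c mu eps, c0 != 0 -> 0 < eps ->
  \forall dl \near 0^'+, forall K K' f e s d h,
    positive_set K -> is_interval K -> derivative_on K f e ->
    power_like k.+1 K dl c0 mu0 e -> shift_near K K' dl f e d s ->
    power_like k.+1 K dl c mu h ->
    power_like k K' eps (c * (mu - mu0)%:~R / c0) (mu - mu0 - 1)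
      (fun x => e x * diff_quotient s d (fun y => h y / e y) x).
Proof.
move=> diffP c0 mu0 c mu eps c00 eps0; pose c1 := c / c0 * (mu - mu0)%:~R / c0.
have /near_right_ex[d1 d10 like_mul] :=
  power_like_mul k c0 c1 mu0 (mu - mu0 - 1 - mu0) eps0.
have /near_right_ex[d2 d20 like_diff] := diffP c0 mu0 (c / c0) (mu - mu0) d1 c00 d10.
have d0 : 0 < Num.min d1 d2 by rewrite lt_min d10.
apply: filterS2 (power_like_div k.+1 c mu mu0 c00 d20) (nbhs_right_le d0).
move=> dl like_div; rewrite le_min => /andP[dl1 dl2].
move=> K K' f e s d h K0 itvK df like_e sP like_h.
have [_ like_quot] := like_div K h e K0 like_h like_e; have [K'K _] := sP.
have -> : c * (mu - mu0)%:~R / c0 = c0 * c1 by rewrite /c1; field.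
have -> : (mu - mu0 - 1 = mu0 + (mu - mu0 - 1 - mu0))%R by ring.
apply: like_mul; [by move=> x /K'K /K0|exact: power_likeW like_e|].
apply: (like_diff K K' f e) => //; first exact: power_likeW like_e.
exact: shift_nearW sP.
Qed.

Lemma power_like_diff_quotient k : diff_quotient_power_like k.
Proof.
elim: k => [|k IH] c0 mu0 c mu eps c00 eps0;
  have /near_right_ex[d1 d10 quot_close_dl] :=
    diff_quotient_close (c * mu%:~R / c0) (mu - 1 - mu0) eps0;
  have like_div := power_like_div 0 (c * mu%:~R) (mu - 1) mu0 c00 d10.
  apply: filterS2 like_div (nbhs_right_le d10) => dl like_div dl1.
  move=> K K' f e s d h K0 itvK df like_e sP /power_like_derive[h' dh like_h'].
  have [e0 [quot_close _]] := like_div K h' e K0 like_h' like_e; split=> //.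
  by apply: (quot_close_dl K K' f e s d h h') => //; exact: shift_nearW sP.
have like_step := power_like_mul_diff_quotient IH mu0 (c * mu%:~R) (mu - 1) c00 eps0.
apply: filterS3 like_div like_step (nbhs_right_le d10) => dl like_div like_step dl1.
move=> K K' f e s d h K0 itvK df like_e sP /power_like_derive[h' dh like_h'].
have [||e0 [quot_close _]] := like_div K h' e K0.
- exact: power_likeW like_h'.
- exact: power_likeW like_e.
split; first by apply: (quot_close_dl K K' f e s d h h') => //; exact: shift_nearW sP.
exists (fun x => e x * diff_quotient s d (fun y => h' y / e y) x).
  exact: derivative_on_diff_quotient sP dh e0.
have -> : c * mu%:~R / c0 * (mu - 1 - mu0)%:~R = c * mu%:~R * (mu - 1 - mu0)%:~R / c0.
  by field.
exact: (like_step K K' f e).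
Qed.

End DifferenceQuotients.

Lemma monotone_onZ (R : realType) (X : {fset R}) (a : R) (g : R -> R) : a != 0 ->
  {in X &, {homo (fun x => a * g x) : x y / x < y}} -> monotone_on X g.
Proof.
move=> a0 inc; have [apos|aneg|/eqP] := ltgtP 0 a; last by rewrite eq_sym (negPf a0).
  left=> x y xX yX; rewrite le_eqVlt => /predU1P[->//|xy].
  by rewrite -(ler_pM2l apos) ltW // inc.
right=> x y xX yX; rewrite le_eqVlt => /predU1P[->//|xy].
by rewrite -(ler_nM2l aneg) ltW // inc.
Qed.

Section EchelonSystems.
Context {R : realType}.
Implicit Types (K : set R) (m n : nat) (dl eps d C : R) (s : R -> R).

Definition echelon_form n (mu : 'I_n -> nat) (c : 'I_n -> R) (L : 'M[R]_n) :=
  [/\ {homo mu : i j / (i < j)%N}, forall j, c j != 0, is_trig_mx L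
    & forall i, L i i = 1].

Definition admissible m K dl (mu : 'I_m.+1 -> nat) (c : 'I_m.+1 -> R) (L : 'M[R]_m.+1)
    (f e : 'I_m.+1 -> R -> R) :=
  [/\ open K, is_interval K, forall x, K x -> 0 < x < dl,
      forall j, power_like m K dl (c j) (mu j) (e j)
    & forall i, derivative_on K (f i) (fun x => \sum_j L i j * e j x)].

Definition uniform_growth m mu c (L : 'M[R]_m.+1) := exists2 C : R, 0 < C &
  \forall dl \near 0^'+, forall K f e, admissible K dl mu c L f e ->
    forall A : {fset R}, {in A, forall x, K x} -> grows C f A.

Lemma admissibleW m K dl dl' mu c L (f e : 'I_m.+1 -> R -> R) : dl <= dl' ->
  admissible K dl mu c L f e -> admissible K dl' mu c L f e.
Proof.
move=> dd' [oK iK Kdl eP df]; split=> // [x /Kdl/andP[-> xdl]|j].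
  exact: lt_le_trans dd'.
exact: power_likeW (eP j).
Qed.

Lemma admissible_positive m K dl mu c L (f e : 'I_m.+1 -> R -> R) :
  admissible K dl mu c L f e -> positive_set K.
Proof. by move=> [_ _ Kdl _ _] x /Kdl/andP[]. Qed.

Lemma admissible_signs m mu c (L : 'M[R]_m.+1) : echelon_form mu c L ->
  exists2 a : 'I_m.+1 -> R, forall i, `|a i| = 1 & \forall dl \near 0^'+,
    forall i K f e, admissible K dl mu c L f e ->
    forall x, K x -> 0 < a i * \sum_j L i j * e j x.
Proof.
move=> [mu_inc c0 _ L1].
have Lii i : L i i != 0 by rewrite L1 oner_neq0.
pose j0 i := [arg min_(j < i | L i j != 0) (j : nat)].
have j0P i : L i (j0 i) != 0 /\ forall j, L i j != 0 -> (j0 i <= j)%N.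
  by rewrite /j0; case: arg_minnP => //= j Lij jmin.
pose l i := L i (j0 i) * c (j0 i).
have l0 i : l i != 0 by rewrite mulf_neq0 // (j0P i).1.
exists (fun i => Num.sg (l i)) => [i|]; first by rewrite normr_sg l0.
apply: filter_forall => i; have [Lj0 j0_min] := j0P i.
have li0 : 0 < `|l i| / 2 by rewrite divr_gt0 ?normr_gt0.
have mu_min j : L i j != 0 -> j != j0 i -> (mu (j0 i))%:Z < (mu j)%:Z.
  move=> /j0_min j0j jj0; rewrite ltz_nat; apply: mu_inc.
  by rewrite ltn_neqAle j0j andbT; apply: contra jj0 => /eqP/val_inj ->.
apply: filterS (power_like_sum c Lj0 mu_min li0) => dl sumP K f e adm.
have K0 := admissible_positive adm; have [_ _ Kdl eP _] := adm.
apply: (power_like_sign K0 _ (sumP K e Kdl _)).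
  by rewrite ltr_pdivrMr // ltr_pMr ?normr_gt0 // ltr1n.
by move=> j; exact: power_likeW (eP j).
Qed.

Lemma echelon_form_signed n mu c (L : 'M[R]_n) (a : 'I_n -> R) :
  (forall i, `|a i| = 1) -> echelon_form mu c L ->
  echelon_form mu (fun j => a j * c j) (\matrix_(i, j) (a i * L i j * a j)).
Proof.
move=> a1 [mu_inc c0 trigL L1]; split=> // [j||i].
- by rewrite mulf_neq0 // -normr_gt0 a1.
- by apply/is_trig_mxP => i j ij; rewrite mxE (is_trig_mxP trigL) // mulr0 mul0r.
- by rewrite mxE L1 mulr1 -expr2 -real_normK ?num_real // a1 expr1n.
Qed.

Lemma sum_signed n (L : 'M[R]_n) (e : 'I_n -> R -> R) (a : 'I_n -> R) i x :
  (forall i, `|a i| = 1) ->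
  \sum_j (\matrix_(i, j) (a i * L i j * a j)) i j * (a j * e j x) =
  a i * \sum_j L i j * e j x.
Proof.
move=> a1; rewrite mulr_sumr; apply: eq_bigr => j _.
rewrite mxE -!mulrA [a j * (a j * _)]mulrA -expr2.
by rewrite -real_normK ?num_real // a1 expr1n mul1r.
Qed.

Lemma admissible_signed m K dl mu c L (f e : 'I_m.+1 -> R -> R) (a : 'I_m.+1 -> R) :
  (forall i, `|a i| = 1) -> admissible K dl mu c L f e ->
  admissible K dl mu (fun j => a j * c j) (\matrix_(i, j) (a i * L i j * a j))
    (fun i x => a i * f i x) (fun j x => a j * e j x).
Proof.
move=> a1 [oK iK Kdl eP df]; split=> // [j|i x Kx].
  by have := power_likeZ (a j) (eP j); rewrite a1 mul1r.
apply: is_derive_eq (@is_deriveZ _ _ _ (f i) (a i) x 1 _ (df i x Kx)) _.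
by rewrite sum_signed.
Qed.

Lemma uniform_growth0 mu c (L : 'M[R]_1) : echelon_form mu c L ->
  uniform_growth mu c L.
Proof.
move=> /admissible_signs[a a1 signP]; exists 1 => //.
apply: filterS signP => dl signP K f e adm A AK; have [_ iK _ _ df] := adm.
exists ord0; rewrite mul1r powRr1 // ler_nat.
apply: leq_trans (fsubset_leq_card (sub_sumdiff_between 0 _)).
rewrite card_in_imfset // => x y xA yA fxy.
have daf : derivative_on K (fun x => a ord0 * f ord0 x)
    (fun x => a ord0 * \sum_j L ord0 j * e j x).
  by move=> z Kz; exact: (@is_deriveZ _ _ _ (f ord0) (a ord0) z 1 _ (df ord0 z Kz)).
have af_pos := signP ord0 K f e adm.
by apply: (derivative_pos_inj iK daf af_pos (AK x xA) (AK y yA)); rewrite /= fxy.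
Qed.

Section Derived.
Context (m : nat) (mu : 'I_m.+2 -> nat) (c : 'I_m.+2 -> R) (L : 'M[R]_m.+2).
Hypothesis ech : echelon_form mu c L.

Definition derived_exponent (j : 'I_m.+1) := (mu (lift ord0 j) - mu ord0 - 1)%N.

Definition derived_coef (j : 'I_m.+1) :=
  c (lift ord0 j) * ((mu (lift ord0 j))%:Z - (mu ord0)%:Z)%:~R / c ord0.

Definition derived_system s d (f : 'I_m.+2 -> R -> R) (i : 'I_m.+1) :=
  diff_quotient s d (f (lift ord0 i)).

Definition derived_basis s d (e : 'I_m.+2 -> R -> R) (j : 'I_m.+1) x :=
  e ord0 x * diff_quotient s d (fun y => e (lift ord0 j) y / e ord0 y) x.

Let mu0_lt j : (mu ord0 < mu (lift ord0 j))%N.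
Proof. by have [mu_inc _ _ _] := ech; exact: mu_inc. Qed.

Lemma derived_echelon_form :
  echelon_form derived_exponent derived_coef (row' ord0 (col' ord0 L)).
Proof.
have [mu_inc c0 trigL L1] := ech; split=> [i j ij|j||i].
- rewrite /derived_exponent; have := mu0_lt i.
  by have : (mu (lift ord0 i) < mu (lift ord0 j))%N by [exact: mu_inc]; lia.
- rewrite !mulf_neq0 ?invr_eq0 // intr_eq0 subr_eq0 eqz_nat gtn_eqF //.
- apply/is_trig_mxP => i j ij; rewrite !mxE; apply/(is_trig_mxP trigL).
  by rewrite !lift0.
- by rewrite !mxE.
Qed.

Lemma echelon_row0 (e : 'I_m.+2 -> R -> R) x : \sum_j L ord0 j * e j x = e ord0 x.
Proof.
have [_ _ trigL L1] := ech; rewrite big_ord_recl /= L1 mul1r big1 ?addr0 // => j _.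
by rewrite (is_trig_mxP trigL) ?mul0r.
Qed.

Lemma derived_admissible eps : 0 < eps -> \forall dl \near 0^'+,
  forall K K' f e s d, admissible K dl mu c L f e -> open K' -> is_interval K' ->
    shift_near K K' dl (f ord0) (e ord0) d s ->
  admissible K' eps derived_exponent derived_coef (row' ord0 (col' ord0 L))
    (derived_system s d f) (derived_basis s d e).
Proof.
move=> eps0; have [_ c0 _ _] := ech.
have stepP : \forall dl \near 0^'+, forall j : 'I_m.+1, forall K K' f e s d h,
    positive_set K -> is_interval K -> derivative_on K f e ->
    power_like m.+1 K dl (c ord0) (mu ord0) e -> shift_near K K' dl f e d s ->
    power_like m.+1 K dl (c (lift ord0 j)) (mu (lift ord0 j)) h ->
    power_like m K' eps (derived_coef j) ((mu (lift ord0 j))%:Z - (mu ord0)%:Z - 1)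
      (fun x => e x * diff_quotient s d (fun y => h y / e y) x).
  apply: filter_forall => j; apply: power_like_mul_diff_quotient => //.
  exact: power_like_diff_quotient.
have dl_small : 0 < Num.min eps `|c ord0| by rewrite lt_min eps0 normr_gt0 c0.
apply: filterS2 stepP (nbhs_right_lt dl_small) => dl stepP.
rewrite lt_min => /andP[dl_eps dl_c] K K' f e s d adm oK' iK' sP.
have [oK iK Kdl eP df] := adm; have K0 := admissible_positive adm.
have e0 x : K x -> e ord0 x != 0 by exact: power_like_neq0 dl_c (eP ord0).
have df0 : derivative_on K (f ord0) (e ord0).
  by move=> x /(df ord0); rewrite echelon_row0.
have [K'K s_shift] := sP.
split=> // [x /K'K/Kdl/andP[-> /lt_trans]|j|i x K'x]; first exact.
  have -> : (derived_exponent j)%:Z = ((mu (lift ord0 j))%:Z - (mu ord0)%:Z - 1)%R.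
    by rewrite /derived_exponent; have := mu0_lt j; lia.
  exact: (stepP j K K' (f ord0)).
have [Ks _ _ _] := s_shift x K'x.
apply: is_derive_eq (derivative_on_diff_quotient sP (df (lift ord0 i)) e0 K'x) _.
have quotE z : K z -> (\sum_j L (lift ord0 i) j * e j z) / e ord0 z =
    L (lift ord0 i) ord0 +
    \sum_j row' ord0 (col' ord0 L) i j * (e (lift ord0 j) z / e ord0 z).
  move=> /e0 n0; rewrite big_ord_recl mulrDl mulfK // mulr_suml; congr (_ + _).
  by apply: eq_bigr => j _; rewrite !mxE mulrA.
rewrite /diff_quotient /= (quotE _ Ks) (quotE _ (K'K x K'x)) opprD addrACA subrr.
rewrite add0r -sumrB mulr_suml mulr_sumr; apply: eq_bigr => j _.
by rewrite /derived_basis /diff_quotient -mulrBr -mulrA mulrCA.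
Qed.

End Derived.

End EchelonSystems.

Section LevelShift.
Context {R : realType} (K : set R) (f e : R -> R) (mu : nat) (lo hi dl d : R).
Hypotheses (openK : open K) (itvK : is_interval K) (K_gt0 : positive_set K).
Hypotheses (lo_gt0 : 0 < lo) (hi_gt0 : 0 < hi) (dl_gt0 : 0 < dl) (d_gt0 : 0 < d).
Hypothesis df : derivative_on K f e.
Hypothesis e_bounds : forall x, K x -> lo * x ^+ mu <= e x <= hi * x ^+ mu.

Definition far_shift_dom := shift_dom K f d `&` [set x | d < lo * dl * x ^+ mu.+1].

Let lodl_gt0 : 0 < lo * dl. Proof. exact: mulr_gt0. Qed.

Let e_gt0 x : K x -> 0 < e x.
Proof.
move=> Kx; have /andP[e_ge _] := e_bounds Kx.
by apply: lt_le_trans e_ge; rewrite mulr_gt0 // exprn_gt0 // K_gt0.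
Qed.

Lemma far_shift_dom_open : open far_shift_dom.
Proof.
apply: openI; first exact: shift_dom_open e_gt0.
pose g (x : R) : R := lo * dl * x ^+ mu.+1.
rewrite (_ : [set x | _] = g @^-1` [set y | d < y]) //.
apply: open_comp; last exact: open_gt.
move=> x _; apply: cvgM; first exact: cvg_cst.
exact: exprn_continuous.
Qed.

Lemma far_shift_dom_interval : is_interval far_shift_dom.
Proof.
move=> x y [Sx dx] [Sy _] z xzy; have Sz := shift_dom_interval itvK df e_gt0 Sx Sy xzy.
split=> //; apply: lt_le_trans dx _; rewrite ler_wpM2l ?(ltW lodl_gt0) //.
have [x0 z0] : 0 < x /\ 0 < z by split; apply: K_gt0; [case: Sx|case: Sz].
by rewrite lerXn2r ?nnegrE ?(ltW x0) ?(ltW z0) //; case/andP: xzy.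
Qed.

Lemma ex_far_shift : [/\ open far_shift_dom, is_interval far_shift_dom
  & exists s, shift_near K far_shift_dom dl f e d s].
Proof.
split; [exact: far_shift_dom_open|exact: far_shift_dom_interval|].
have [s sP] := ex_shift openK itvK d_gt0 df e_gt0.
exists s; split=> [x [[]]//|x [Sx dx]]; have [Ks xs fs ds] := sP x Sx; split=> //.
rewrite xs /=; have [Kx _] := Sx.
apply: (shift_close itvK df e_gt0 K_gt0 lo_gt0 _ dl_gt0 Kx Ks fs dx) => z Kz.
by case/andP: (e_bounds Kz).
Qed.

Context (A A0 : {fset R}) (succ : R -> R).
Hypotheses (AK : {in A, forall x, K x}) (succA : immediate_successor A A0 succ).

Let X := level A0 (gap succ f) d.

Let levelP x : x \in X -> [/\ x \in A0, K x, K (succ x) & f (succ x) = f x + d].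
Proof.
rewrite !inE => /andP[xA0 /eqP gx]; have [xA sxA _ _] := succA xA0.
by split=> //; [exact: AK|exact: AK|rewrite -gx addrC subrK].
Qed.

Lemma level_far_shift_dom r y : hi < r%:R * (lo * dl) -> y \in X ->
  (r <= #|` below X y|)%N -> far_shift_dom y.
Proof.
move=> r_large yX r_le; have [_ Ky Ksy fsy] := levelP yX.
split; first by split=> //; exists (succ y).
have sep : {in X &, forall z w, z < w -> f z + d <= f w}.
  move=> z w /levelP[zA0 Kz Ksz <-] /levelP[wA0 Kw _ _] zw.
  have [[_ _ _ succ_min] [wA _ _ _]] := (succA zA0, succA wA0).
  by rewrite (derivative_pos_le itvK df e_gt0) // succ_min.
have e_le x : K x -> e x <= hi * x ^+ mu by move=> /e_bounds/andP[].
have XK x : x \in X -> K x by case/levelP.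
have rd := separated_rank_le itvK K_gt0 df hi_gt0 (ltW d_gt0) e_le XK sep yX r_le.
have y0 : 0 < y ^+ mu.+1 by rewrite exprn_gt0 // K_gt0.
have r0 : 0 < r%:R :> R by rewrite -(pmulr_lgt0 _ lodl_gt0) (lt_trans hi_gt0).
by rewrite /= -(ltr_pM2l r0) (le_lt_trans rd) // mulrA ltr_pM2r.
Qed.

Lemma shift_level K' s y : shift_near K K' dl f e d s -> K' y -> y \in X ->
  s y = succ y.
Proof.
move=> [_ sP] /sP[Ks _ fs _] /levelP[_ _ Ksy fsy].
by apply: (derivative_pos_inj itvK df e_gt0 Ks Ksy); rewrite fs fsy.
Qed.

End LevelShift.

Section UniformGrowth.
Context {R : realType}.
Implicit Types (K : set R) (dl C : R).

Lemma admissible_monotone_grows m K dl mu c L (f e : 'I_m.+1 -> R -> R)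
    (a : 'I_m.+1 -> R) C d (G : 'I_m.+1 -> R -> R) (Y : {fset R}) :
  admissible K dl mu c L f e -> (forall i, a i != 0) ->
  (forall i x, K x -> 0 < a i * \sum_j L i j * e j x) -> {in Y, forall x, K x} ->
  d != 0 -> (forall i, {in Y, f i =1 fun x => d * G i x}) -> grows C f Y ->
  (forall i, monotone_on Y (G i)) /\ grows C G Y.
Proof.
move=> [_ itvK _ _ df] a0 signs YK d0 fE f_grows; split=> [i|]; last first.
  exact: (growsZ (a := fun=> d) (fun=> d0) (eq_in_grows fE f_grows)).
apply: (monotone_onZ (mulf_neq0 (a0 i) d0)) => x y xY yY; rewrite -!mulrA -!fE //.
have daf : derivative_on K (fun x => a i * f i x) (fun x => a i * \sum_j L i j * e j x).
  by move=> z Kz; exact: (@is_deriveZ _ _ _ (f i) (a i) z 1 _ (df i z Kz)).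
by rewrite (derivative_pos_lt itvK daf (signs i)) //; exact: YK.
Qed.

(* Only boundedly many points of a level set of the gaps of [f ord0] are too close
   to [0] for the derived system to be defined there. *)
Lemma ex_level_derived_system m mu c (L : 'M[R]_m.+2) eps : echelon_form mu c L ->
  0 < eps -> exists r, \forall dl \near 0^'+, forall K f e,
    admissible K dl mu c L f e -> (forall x, K x -> 0 < e ord0 x) ->
    forall (A A0 : {fset R}) succ d, {in A, forall x, K x} ->
    immediate_successor A A0 succ -> 0 < d ->
    let X := level A0 (gap succ (f ord0)) d in
    exists K' s, [/\ admissible K' eps (derived_exponent mu) (derived_coef mu c)
        (row' ord0 (col' ord0 L)) (derived_system s d f) (derived_basis s d e),
      {in X, forall y, (r <= #|` below X y|)%N -> K' y}
    & {in X, forall y, K' y -> s y = succ y}].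
Proof.
move=> ech /(derived_admissible ech) /near_right_ex[dl1 dl1_gt0 derivedP].
have nc0 : 0 < `|c ord0| by have [_ c0 _ _] := ech; rewrite normr_gt0.
have [lo0 hi0] : 0 < `|c ord0| / 2 /\ 0 < 2 * `|c ord0|.
  by rewrite divr_gt0 // mulr_gt0.
pose r := Num.bound (2 * `|c ord0| / (`|c ord0| / 2 * dl1)); exists r.
have r_large : 2 * `|c ord0| < r%:R * (`|c ord0| / 2 * dl1).
  rewrite -ltr_pdivrMr ?mulr_gt0 // archi_boundP //.
  by rewrite divr_ge0 ?(ltW hi0) // mulr_ge0 ?(ltW lo0) ?(ltW dl1_gt0).
have dl_small : 0 < Num.min dl1 (`|c ord0| / 2) by rewrite lt_min dl1_gt0.
apply: filterS (nbhs_right_le dl_small) => dl; rewrite le_min => /andP[dl_dl1 dl_c].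
move=> K f e adm e_gt0 A A0 succ d AK succA d0.
have K0 := admissible_positive adm; have [oK iK Kdl eP df] := adm.
have df0 : derivative_on K (f ord0) (e ord0).
  by move=> x /(df ord0); rewrite (echelon_row0 ech).
have e_bounds := power_like_bounds K0 e_gt0 dl_c (power_likeW (leq0n _)
  (@subset_refl _ K) (lexx dl) (eP ord0)).
have [oK' iK' [s sP]] := ex_far_shift oK iK K0 lo0 dl1_gt0 d0 df0 e_bounds.
exists (far_shift_dom K (f ord0) (mu ord0) (`|c ord0| / 2) dl1 d), s; split.
- by apply: (derivedP K) => //; exact: admissibleW adm.
- move=> y; exact: (level_far_shift_dom iK K0 lo0 hi0 dl1_gt0 d0 df0 e_bounds AK).
- move=> y yX K'y; exact: (shift_level iK K0 lo0 df0 e_bounds AK succA sP K'y yX).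
Qed.

Lemma level_sets_grow m mu c (L : 'M[R]_m.+2) : echelon_form mu c L ->
  uniform_growth (derived_exponent mu) (derived_coef mu c) (row' ord0 (col' ord0 L)) ->
  exists2 C', 0 < C' & exists r, \forall dl \near 0^'+, forall K f e,
    admissible K dl mu c L f e -> (forall x, K x -> 0 < e ord0 x) ->
    forall (A A0 : {fset R}) succ d, {in A, forall x, K x} ->
    immediate_successor A A0 succ -> 0 < d ->
    monotone_grows_above r C' (fun i => gap succ (f (lift ord0 i)))
      (level A0 (gap succ (f ord0)) d).
Proof.
move=> ech [C' C'0 growP]; exists C' => //.
have [a a1 signP] := admissible_signs (derived_echelon_form ech).
have [eps [eps0 {growP signP}[growP signP]]] :=
  filter_ex (filterI (nbhs_right_gt 0) (filterI growP signP)).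
have [r derivedP] := ex_level_derived_system ech eps0; exists r.
apply: filterS derivedP => dl derivedP K f e adm e_gt0 A A0 succ d AK succA d0.
have [K' [s [adm' level_K' s_succ]]] := derivedP K f e adm e_gt0 A A0 succ d AK succA d0.
move=> Y /fsubsetP YX Y_above.
have YK' : {in Y, forall x, K' x}.
  by move=> x xY; apply: level_K' (Y_above x xY); exact: YX.
have derivedE i : {in Y, derived_system s d f i =1
    fun x => d^-1 * gap succ (f (lift ord0 i)) x}.
  move=> x xY; rewrite /derived_system /diff_quotient mulrC.
  by rewrite (s_succ x (YX x xY) (YK' x xY)).
have a_neq0 i : a i != 0 by rewrite -normr_gt0 a1.
have dV0 : d^-1 != 0 by rewrite invr_eq0 gt_eqF.
apply: (admissible_monotone_grows adm' a_neq0 _ YK' dV0 derivedE).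
  by move=> i; exact: signP adm'.
exact: (growP K' _ _ adm').
Qed.

Lemma uniform_growthS m : (forall mu c (L : 'M[R]_m.+1), echelon_form mu c L ->
    uniform_growth mu c L) ->
  forall mu c (L : 'M[R]_m.+2), echelon_form mu c L -> uniform_growth mu c L.
Proof.
move=> IH mu c L ech; have [a a1 signP] := admissible_signs ech.
have ech' := echelon_form_signed a1 ech.
have [C' C'0 [r level_grows]] :=
  level_sets_grow ech' (IH _ _ _ (derived_echelon_form ech')).
have [C C0 growP] := growth_step m r C'0; exists C => //.
apply: filterS2 signP level_grows => dl signP level_grows K f e adm A AK.
have adm' := admissible_signed a1 adm.
have signs i x : K x ->
    0 < \sum_j (\matrix_(i, j) (a i * L i j * a j)) i j * (a j * e j x).
  by move=> Kx; rewrite sum_signed //; exact: signP adm x Kx.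
have ai0 i : a i != 0 by rewrite -normr_gt0 a1.
have e0 x : K x -> 0 < a ord0 * e ord0 x.
  by move=> /(signs ord0); rewrite (echelon_row0 ech' (fun j x => a j * e j x)).
have [A0 [succ [succA cA0]]] := ex_immediate_successor A.
apply: (growsZ ai0); apply: (growP A A0 succ) => // [i x y xA yA|d d0].
  have [_ iK _ _ df] := adm'.
  by rewrite (derivative_pos_lt iK (df i) (signs i)) //; exact: AK.
exact: (level_grows K _ _ adm' e0 A A0 succ d).
Qed.

Lemma echelon_uniform_growth m mu c (L : 'M[R]_m.+1) : echelon_form mu c L ->
  uniform_growth mu c L.
Proof.
elim: m mu c L => [|m IH]; first exact: uniform_growth0.
exact: uniform_growthS.
Qed.

End UniformGrowth.

Section PowerSeries.
Context {R : realType}.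
Implicit Types (b : nat -> R) (r x z t dl : R) (phi : R -> R) (m k : nat).

Lemma mul_expr_le (q : R) n : 0 <= q -> q <= 1 ->
  n.+1%:R * q ^+ n * (1 - q) <= 1 - q ^+ n.+1.
Proof.
move=> q0 q1; rewrite -[X in X - _ ^+ _](expr1n R n.+1) subrXX mulrC.
rewrite ler_wpM2l ?subr_ge0 //.
rewrite mulr_natl -[n.+1 in leLHS]card_ord -sumr_const; apply: ler_sum => i _.
by rewrite expr1n mul1r ler_wiXn2l // -ltnS.
Qed.

Lemma is_cvg_pseries_diffs b x z : cvgn (pseries b x) -> `|z| < `|x| ->
  cvgn (pseries (pseries_diffs b) z).
Proof.
move=> cvgx zx; have [M [_ b_le]] := cvg_series_bounded cvgx.
have {b_le} b_le n : `|b n.+1| * `|x| ^+ n.+1 <= `|M| + 1.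
  rewrite -normrX -normrM; apply: b_le => //.
  by rewrite (le_lt_trans (ler_norm M)) ?ltrDl.
have x0 : 0 < `|x| := le_lt_trans (normr_ge0 z) zx.
have q0 : 0 <= `|z| / `|x| by rewrite divr_ge0.
pose p := Num.sqrt (`|z| / `|x|); have p0 : 0 <= p := sqrtr_ge0 _.
have p1 : p < 1 by rewrite -sqrtr1 ltr_sqrt // ltr_pdivrMr // mul1r.
have p10 : 0 < 1 - p by rewrite subr_gt0.
apply: normed_cvg.
apply: (@series_le_cvg _ _ (geometric ((`|M| + 1) / `|x| / (1 - p)) p)) => [n|n|n|] //=.
- by rewrite mulr_ge0 ?exprn_ge0 // !divr_ge0 ?(ltW p10) // addr_ge0.
- have -> : `|pseries_diffs b n * z ^+ n| =
      `|b n.+1| * `|x| ^+ n.+1 / `|x| * (n.+1%:R * p ^+ n * p ^+ n).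
    have pp : p ^+ n * p ^+ n = (`|z| / `|x|) ^+ n by rewrite -exprMn -expr2 sqr_sqrtr.
    rewrite -(mulrA n.+1%:R) pp expr_div_n /pseries_diffs !normrM normrX exprS.
    by rewrite ger0_norm //; field; rewrite expf_neq0 ?gt_eqF.
  rewrite -[leRHS]mulrA; apply: ler_pM; rewrite ?mulr_ge0 ?exprn_ge0 ?invr_ge0 //.
    by rewrite ler_wpM2r ?invr_ge0.
  rewrite ler_wpM2r ?exprn_ge0 // -[leRHS]mul1r ler_pdivlMr //.
  by rewrite (le_trans (mul_expr_le n p0 (ltW p1))) // gerBl exprn_ge0.
- by apply: is_cvg_geometric_series; rewrite ger0_norm.
Qed.

Definition has_pseries b r phi := forall t, `|t| < r -> pseries b t @ \oo --> phi t.

Lemma has_pseriesW b r r' phi : r' <= r -> has_pseries b r phi -> has_pseries b r' phi.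
Proof. by move=> rr' ps t tr; apply: ps; exact: lt_le_trans rr'. Qed.

Lemma pseries_at0 b : pseries b 0 @ \oo --> b 0%N.
Proof.
apply: cvg_near_cst; exists 1%N => // -[//|n] _.
rewrite /pseries /series /= big_nat_recl // expr0 mulr1.
by rewrite big1 ?addr0 // => i _; rewrite expr0n /= mulr0.
Qed.

Lemma has_pseries_at0 b r phi : 0 < r -> has_pseries b r phi -> phi 0 = b 0%N.
Proof.
move=> r0 /(_ 0); rewrite normr0 => /(_ r0) cvg0.
by apply: cvg_unique cvg0 _ => //; exact: pseries_at0.
Qed.

Lemma has_pseries_eq0 b r phi t : has_pseries b r phi -> (forall k, b k = 0) ->
  `|t| < r -> phi t = 0.
Proof.
move=> ps b0 /ps cvg_t; apply: cvg_unique cvg_t _ => //.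
rewrite /pseries (_ : series _ = cst 0); first exact: cvg_cst.
by apply/funext => k; rewrite /series /= big1 // => i _; rewrite b0 mul0r.
Qed.

Lemma has_pseries_sum n (c : 'I_n -> R) (b : 'I_n -> nat -> R)
    (phi : 'I_n -> R -> R) r :
  (forall i, has_pseries (b i) r (phi i)) ->
  has_pseries (fun k => \sum_i c i * b i k) r (fun t => \sum_i c i * phi i t).
Proof.
move=> ps t tr.
have -> : pseries (fun k => \sum_i c i * b i k) t =
    (fun k => \sum_i c i * pseries (b i) t k).
  apply/funext => k; rewrite /pseries /series /=.
  under [RHS]eq_bigr do rewrite mulr_sumr.
  rewrite exchange_big; apply: eq_bigr => j _ /=; rewrite mulr_suml.
  by apply: eq_bigr => i _; rewrite mulrA.
apply: cvg_big => [|i _]; first exact: add_continuous.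
by apply: cvgM; [exact: cvg_cst|exact: ps].
Qed.

Lemma has_pseriesN b r phi : has_pseries b r phi ->
  has_pseries (fun k => (-1) ^+ k * b k) r (fun t => phi (- t)).
Proof.
move=> ps t tr.
have -> : pseries (fun k => (-1) ^+ k * b k) t = pseries b (- t).
  apply/funext => n; rewrite /pseries /series /=; apply: eq_bigr => i _.
  by rewrite -[- t]mulN1r exprMn; ring.
by apply: ps; rewrite normrN.
Qed.

Lemma has_pseries_shift m b r phi : has_pseries b r phi ->
  (forall k, (k < m)%N -> b k = 0) ->
  has_pseries (fun k => b (k + m)%N) r
    (fun t => if t == 0 then b m else phi t / t ^+ m).
Proof.
move=> ps b0 t tr; case: eqVneq => [->|t0]; first exact: pseries_at0.
have tm0 : t ^+ m != 0 by rewrite expf_neq0.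
have -> : pseries (fun k => b (k + m)%N) t = (fun n => pseries b t (n + m)%N / t ^+ m).
  apply/funext => n; rewrite /pseries /series /= addnC.
  rewrite (big_cat_nat (leq0n m) (leq_addr n m)) /= [X in X + _]big1_seq ?add0r.
    rewrite -[X in (\sum_(X <= _ < _) _) / _]add0n big_addn addKn mulr_suml.
    by apply: eq_bigr => k _; rewrite exprD mulrA mulfK.
  by move=> k /andP[_]; rewrite mem_index_iota => /andP[_ km]; rewrite b0 ?mul0r.
apply: cvgM; last exact: cvg_cst.
by have := ps t tr; rewrite -(cvg_shiftn m).
Qed.

Lemma has_pseries_derive b r phi : has_pseries b r phi ->
  exists2 phi', has_pseries (pseries_diffs b) r phi' &
    forall t, `|t| < r -> is_derive t 1 phi (phi' t).
Proof.
move=> ps; have mid x : `|x| < r -> exists2 y : R, `|x| < `|y| & `|y| < r.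
  move=> xr; have x0 := normr_ge0 x.
  have y0 : 0 <= (`|x| + r) / 2 by move: x0 xr; clear; lra.
  by exists ((`|x| + r) / 2); rewrite (ger0_norm y0); move: xr; clear; lra.
have cvgb x : `|x| < r -> cvgn (pseries b x) by move=> /ps; exact: cvgP.
have cvgd x : `|x| < r -> cvgn (pseries (pseries_diffs b) x).
  by move=> /mid[y xy /cvgb yr]; exact: is_cvg_pseries_diffs yr xy.
have cvgdd x : `|x| < r -> cvgn (pseries (pseries_diffs (pseries_diffs b)) x).
  by move=> /mid[y xy /cvgd yr]; exact: is_cvg_pseries_diffs yr xy.
exists (fun t => limn (pseries (pseries_diffs b) t)) => t tr; first exact: cvgd.
have [y ty yr] := mid t tr.
apply: (@near_eq_is_derive _ _ _ (fun t => limn (pseries b t))); last first.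
  exact: pseries_snd_diffs (cvgb y yr) (cvgd y yr) (cvgdd y yr) ty.
near=> x; apply: cvg_lim => //; apply: ps.
suff : ball t (r - `|t|) x.
  rewrite /ball /= => tx; rewrite -(subKr t x) (le_lt_trans (ler_normB _ _)) //.
  by move: tx; lra.
by near: x; apply: nbhsx_ballx; rewrite subr_gt0.
Unshelve. all: by end_near.
Qed.

Lemma has_pseries_continuous0 b r phi : 0 < r -> has_pseries b r phi ->
  phi t @[t --> 0] --> b 0%N.
Proof.
move=> r0 ps; have [phi' _ dphi] := has_pseries_derive ps.
have [d0 _] : is_derive (0 : R) 1 phi (phi' 0) by apply: dphi; rewrite normr0.
rewrite -(has_pseries_at0 r0 ps).
exact/differentiable_continuous/derivable1_diffP.
Qed.

Lemma has_pseries_leading m b r phi : 0 < r -> has_pseries b r phi ->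
  (forall k, (k < m)%N -> b k = 0) -> phi t / t ^+ m @[t --> 0^'] --> b m.
Proof.
move=> r0 ps /(has_pseries_shift ps) /(has_pseries_continuous0 r0) cvg_shift.
apply: cvg_trans (cvg_within_filter _ cvg_shift); apply: near_eq_cvg.
by near=> t do rewrite ifN_eq //; exact: nbhs_dnbhs_neq.
Unshelve. all: by end_near.
Qed.

Lemma has_pseries_isolated_zero b r phi : 0 < r -> has_pseries b r phi ->
  (exists k, b k != 0) -> \forall t \near 0^', phi t != 0.
Proof.
move=> r0 ps exb; have [m bm m_min] := ex_minnP exb.
have b0 k : (k < m)%N -> b k = 0.
  by move=> km; apply/eqP; apply: contraTT km => /m_min; rewrite -leqNgt.
have /cvgr_neq0 := has_pseries_leading r0 ps b0; move=> /(_ bm).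
by apply: filterS => t; apply: contraNneq => ->; rewrite mul0r.
Qed.

Lemma identity_theorem (J : set R) (h : R -> R) (x0 : R) : is_interval J ->
  (forall x, J x ->
    exists2 r, 0 < r & exists b, has_pseries b r (fun t => h (x + t))) ->
  J x0 -> (\forall x \near x0, h x = 0) -> forall x, J x -> h x = 0.
Proof.
move=> /connected_intervalP connJ h_ps Jx0 hx0.
pose Z := interior [set x | h x = 0].
suff JZ : J `&` Z = J by move=> x; rewrite -{1}JZ => -[_ /nbhs_singleton].
apply: connJ; [by exists x0|by exists Z => //; exact: open_interior|].
exists (closure Z); first exact: closed_closure.
apply/seteqP; split=> x [Jx xZ]; split=> //; first exact: subset_closure.
have [r r0 [b ps]] := h_ps x Jx.
have [exb|nexb] := pselect (exists k, b k != 0); last first.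
  have b0 k : b k = 0 by apply: contra_notP nexb => /eqP; exists k.
  apply/nbhs_ballP; exists r => // y; rewrite /ball /= distrC => yx.
  by have := has_pseries_eq0 ps b0 yx; rewrite /= (addrC x) subrK.
have := has_pseries_isolated_zero r0 ps exb.
rewrite near_withinE => /nbhs_ballP[eps /= eps0 h_neq0].
have [|z [zZ xz]] := xZ (ball x eps); first exact: nbhsx_ballx.
have hz : h z = 0 by exact: (nbhs_singleton zZ).
have [->//|zx] := eqVneq x z.
have := h_neq0 (z - x); rewrite /= (addrC x) subrK hz eqxx.
rewrite /ball /= sub0r normrN distrC subr_eq0 eq_sym => /(_ xz zx).
by [].
Qed.

Definition int_coef b (mu : int) := if mu is Posz m then b m else 0.

Lemma int_coef_diffs b mu :
  int_coef (pseries_diffs b) (mu - 1) = int_coef b mu * mu%:~R.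
Proof.
case: mu => [[|m]|m]; first by rewrite mulr0.
  by have -> : (m.+1%:Z - 1 = m)%R by [lia]; rewrite /= mulrC.
by have -> : (Negz m - 1 = Negz m.+1)%R by [lia]; rewrite /= mul0r.
Qed.

Lemma has_pseries_exprz (mu : int) b r phi : 0 < r -> has_pseries b r phi ->
  (forall k, k%:Z < mu -> b k = 0) -> phi t / t ^ mu @[t --> 0^'] --> int_coef b mu.
Proof.
case: mu => m r0 ps b0; first exact: (has_pseries_leading r0 ps).
apply: cvg_within_filter.
rewrite (_ : (fun t => _) = (fun t => phi t * t ^+ m.+1)); last first.
  by apply/funext => t; rewrite /exprz invrK.
have -> : int_coef b (Negz m) = b 0%N * 0 ^+ m.+1 by rewrite expr0n mulr0.
by apply: cvgM; [exact: has_pseries_continuous0 r0 ps|exact: exprn_continuous].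
Qed.

Lemma has_pseries_power_like k (mu : int) b r phi dl : 0 < r -> 0 < dl ->
  has_pseries b r phi -> (forall j, j%:Z < mu -> b j = 0) ->
  \forall eps \near 0^'+,
    power_like k [set t | 0 < t < eps] dl (int_coef b mu) mu phi.
Proof.
move=> r0 dl0; elim: k mu b phi => [|k IH] mu b phi ps b0.
all: have /cvg_dnbhs_at_right/cvgrPdist_le/(_ dl dl0)/near_right_interval lead :=
  has_pseries_exprz r0 ps b0.
  by apply: filterS lead => eps lead; split=> // t /lead; rewrite distrC.
have [phi' ps' dphi] := has_pseries_derive ps.
have diffs0 j : j%:Z < mu - 1 -> pseries_diffs b j = 0.
  by move=> jmu; rewrite /pseries_diffs b0 ?mulr0 //; lia.
apply: filterS3 lead (IH (mu - 1) _ phi' ps' diffs0) (nbhs_right_le r0).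
move=> eps lead like_phi' eps_r; split=> [t /lead|]; first by rewrite distrC.
exists phi' => [t /andP[t0 te]|]; last by rewrite -int_coef_diffs.
by apply: dphi; rewrite gtr0_norm // (lt_le_trans te).
Qed.

End PowerSeries.

Section Elimination.
Context {F : fieldType}.
Implicit Types n : nat.

Definition independent n (b : 'I_n -> nat -> F) := forall c : 'I_n -> F,
  (forall k, \sum_i c i * b i k = 0) -> forall i, c i = 0.

Lemma independentZ n (b : 'I_n -> nat -> F) (w : nat -> F) : (forall k, w k != 0) ->
  independent b -> independent (fun i k => w k * b i k).
Proof.
move=> w0 ind c cb; apply: ind => k; apply/eqP; rewrite -(mulrI_eq0 _ (mulfI (w0 k))).
by rewrite mulr_sumr -[X in _ == X](cb k); apply/eqP/eq_bigr => i _; rewrite mulrCA.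
Qed.

Lemma independent_leading n (b : 'I_n.+1 -> nat -> F) : independent b ->
  exists q m, b q m != 0 /\ forall i k, (k < m)%N -> b i k = 0.
Proof.
move=> ind; have exk : exists k, [exists i, b i k != 0].
  apply: contrapT => nex; suff : (1 : F) = 0 by apply/eqP/oner_neq0.
  apply: (ind (fun=> 1) _ ord0) => k; rewrite big1 // => i _.
  apply/eqP; rewrite mul1r; apply: contra_notT nex => bik.
  by exists k; apply/existsP; exists i.
have [m /existsP[q bqm] m_min] := ex_minnP exk; exists q, m; split=> // i k.
by apply: contraTeq => bik; rewrite -leqNgt m_min //; apply/existsP; exists i.
Qed.

Lemma independent_eliminate n (b : 'I_n.+1 -> nat -> F) (q : 'I_n.+1) (a : 'I_n -> F) :
  independent b -> independent (fun i k => b (lift q i) k - a i * b q k).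
Proof.
move=> ind c cb i.
pose c' j := oapp c (- \sum_l c l * a l) (unlift q j).
suff /(_ (lift q i)) : forall j, c' j = 0 by rewrite /c' liftK.
apply: ind => k; rewrite (bigD1_ord q) //= /c' unlift_none /= -[RHS](cb k).
rewrite mulNr mulr_suml addrC -sumrB; apply: eq_bigr => j _.
by rewrite liftK /=; ring.
Qed.

Definition echelon_decomposition k0 n (b : 'I_n -> nat -> F) (s : 'S_n)
    (mu : 'I_n -> nat) (beta : 'I_n -> nat -> F) (L : 'M[F]_n) :=
  [/\ {homo mu : i j / (i < j)%N},
      forall j, [/\ (k0 <= mu j)%N, beta j (mu j) != 0
                  & forall k, (k < mu j)%N -> beta j k = 0],
      is_trig_mx L, forall i, L i i = 1
    & forall i k, b (s i) k = \sum_j L i j * beta j k].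

Lemma echelon_decompositionW k0 k1 n (b : 'I_n -> nat -> F) s mu beta L :
  (k0 <= k1)%N ->
  echelon_decomposition k1 b s mu beta L -> echelon_decomposition k0 b s mu beta L.
Proof.
move=> k01 [mu_inc betaP trigL L1 bE]; split=> // j; have [k1j] := betaP j.
by split=> //; exact: leq_trans k1j.
Qed.

Lemma echelon_decomposition_pivot n (b : 'I_n.+1 -> nat -> F) (q : 'I_n.+1) m
    (a : 'I_n -> F) (s : 'S_n) mu beta L :
  b q m != 0 -> (forall k, (k < m)%N -> b q k = 0) ->
  echelon_decomposition m.+1 (fun i k => b (lift q i) k - a i * b q k) s mu beta L ->
  echelon_decomposition m b (lift_perm ord0 q s)
    (fun j => oapp mu m (unlift ord0 j)) (fun j => oapp beta (b q) (unlift ord0 j))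
    (\matrix_(i, j) if unlift ord0 i is Some i'
                    then oapp (L i') (a (s i')) (unlift ord0 j)
                    else (j == ord0)%:R).
Proof.
move=> bqm bq0 [mu_inc betaP trigL L1 bE]; split=> [i j|j||i|i k].
- case: (unliftP ord0 i) (unliftP ord0 j) => [i'|] -> [j'|] ->; rewrite ?lift0 //=.
    by rewrite ltnS; exact: mu_inc.
  by have [] := betaP j'.
- case: (unliftP ord0 j) => [j' _|_] //=.
  by have [mj] := betaP j'; split=> //; exact: ltnW.
- apply/is_trig_mxP => i j; rewrite mxE.
  case: (unliftP ord0 i) (unliftP ord0 j) => [i'|] -> [j'|] ->; rewrite ?lift0 //=.
  by rewrite ltnS => /(is_trig_mxP trigL).
- by rewrite mxE; case: (unliftP ord0 i) => [i' _|->] //=; rewrite eqxx.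
rewrite big_ord_recl mxE; case: (unliftP ord0 i) => [i'|] ->; last first.
  rewrite lift_perm_id unlift_none /= mul1r big1 ?addr0 // => j _.
  by rewrite mxE unlift_none /= mul0r.
rewrite lift_perm_lift unlift_none /= -(subrK (a (s i') * b q k) (b _ k)) bE addrC.
by congr (_ + _); apply: eq_bigr => j _; rewrite mxE !liftK.
Qed.

(* Gaussian elimination, choosing at each step the row with the leftmost pivot. *)
Lemma ex_echelon_decomposition k0 n (b : 'I_n -> nat -> F) : independent b ->
  (forall i k, (k < k0)%N -> b i k = 0) ->
  exists s mu beta L, echelon_decomposition k0 b s mu beta L.
Proof.
elim: n b k0 => [|n IH] b k0 ind bk0.
  exists 1%g, (fun=> 0%N), (fun _ _ => 0), 0.
  by split=> [[]|[]||[]|[]] //; exact: mx0_is_trig.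
have [q [m [bqm bm0]]] := independent_leading ind.
have k0m : (k0 <= m)%N by rewrite leqNgt; apply: contra_neqN bqm => /bk0; exact.
pose a i := b (lift q i) m / b q m.
have [i k|s [mu [beta [L ech]]]] :=
    IH _ m.+1 (independent_eliminate (q := q) (a := a) ind).
  rewrite ltnS leq_eqVlt => /predU1P[->|km]; first by rewrite divfK // subrr.
  by rewrite !bm0 // mulr0 subrr.
do 4 eexists.
exact: echelon_decompositionW k0m (echelon_decomposition_pivot bqm (bm0 q) ech).
Qed.

Lemma unitriangular_unit n (L : 'M[F]_n) :
  is_trig_mx L -> (forall i, L i i = 1) -> L \in unitmx.
Proof.
by move=> trigL L1; rewrite unitmxE det_trig // big1 ?unitr1 // => i _; rewrite L1.
Qed.

Lemma mulmx_invl_sum n (L : 'M[F]_n) (u v : 'I_n -> F) : L \in unitmx ->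
  (forall i, u i = \sum_j L i j * v j) -> forall j, v j = \sum_i invmx L j i * u i.
Proof.
move=> unitL uv j; have -> : v j = (invmx L *m (L *m \col_l v l)) j ord0.
  by rewrite mulKmx // mxE.
rewrite mxE; apply: eq_bigr => i _; congr (_ * _).
by rewrite mxE uv; apply: eq_bigr => l _; rewrite mxE.
Qed.

End Elimination.

Section Expansion.
Context {R : realType} (m : nat).
Implicit Types (f g : 'I_m.+1 -> R -> R) (E K : set R) (A X : {fset R}).

Definition expands_on f E := exists2 C : R, 0 < C &
  forall A, {in A, forall x, E x} -> grows C f A.

Lemma expands_onS f E E' : E' `<=` E -> expands_on f E -> expands_on f E'.
Proof.
by move=> EE' [C C0 growsC]; exists C => // A AE; apply: growsC => x /AE /EE'.
Qed.

Lemma expands_on1 f x0 : expands_on f [set x0].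
Proof.
exists 1 => // A Ax; apply: grows_small; rewrite mul1r.
have A1 : (#|` A| <= 1)%N.
  rewrite -(cardfs1 x0); apply/fsubset_leq_card/fsubsetP => x /Ax ->.
  by rewrite inE.
case: #|` A| A1 => [|[|//]] _; last by rewrite powR1.
by rewrite powR0 // gt_eqF ?phi_gt0.
Qed.

Lemma expands_on0 f : expands_on f set0.
Proof. exact: expands_onS (@sub0set _ _) (expands_on1 f 0). Qed.

Lemma grows_half C f A X : 0 <= C -> (X `<=` A)%fset -> (#|` A| <= 2 * #|` X|)%N ->
  grows C f X -> grows (C * 2^-1 `^ phi R m.+1) f A.
Proof.
move=> C0 XA AX [i iC]; exists i; have p0 := phi_gt0 (R := R) m.
apply: (@le_trans _ _ #|` sumdiff_between m (f i @` X)%fset|%:R).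
  apply: le_trans iC; rewrite -mulrA -powRM ?invr_ge0 // ler_wpM2l //.
  rewrite ge0_ler_powR ?nnegrE ?(ltW p0) ?mulr_ge0 ?invr_ge0 //.
  by rewrite mulrC ler_pdivrMr // mulrC -natrM ler_nat.
rewrite ler_nat; apply/fsubset_leq_card/sumdiff_betweenS/fsubsetP.
move=> _ /imfsetP[x /= xX ->].
by rewrite in_imfset //=; exact: (fsubsetP XA).
Qed.

Lemma expands_onU f E E' : expands_on f E -> expands_on f E' -> expands_on f (E `|` E').
Proof.
move=> [C C0 growsC] [C' C'0 growsC'].
have half_gt0 : 0 < 2^-1 `^ phi R m.+1 :> R by rewrite powR_gt0.
exists (Num.min C C' * (2^-1 `^ phi R m.+1)); first by rewrite mulr_gt0 // lt_min C0.
move=> A AE; pose X := [fset x in A | `[< E x >]]%fset.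
have XA : (X `<=` A)%fset by apply/fsubsetP => x; rewrite !inE => /andP[].
have cA : #|` A| = (#|` X| + #|` (A `\` X)%fset|)%N.
  by rewrite -(cardfsID X A) (fsetIidPr XA).
have [XX'|X'X] := leqP #|` (A `\` X)%fset| #|` X|.
  apply: (@grows_le _ _ (C * (2^-1 `^ phi R m.+1))).
    by rewrite ler_pM2r // ge_min lexx.
  apply: (grows_half (ltW C0) XA); first by rewrite cA; lia.
  by apply: growsC => x; rewrite !inE => /andP[_ /asboolP].
apply: (@grows_le _ _ (C' * (2^-1 `^ phi R m.+1))).
  by rewrite ler_pM2r // ge_min lexx orbT.
apply: (grows_half (ltW C'0) (fsubsetDl A X)); first by rewrite cA; lia.
apply: growsC' => x; rewrite !inE negb_and => /andP[/orP[/negP//|/asboolPn nE] xA].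
by case: (AE x xA).
Qed.

Lemma expands_on_image f (h : R -> R) E : injective h ->
  expands_on (fun i => f i \o h) E -> expands_on f (h @` E).
Proof.
move=> h_inj [C C0 growsC]; exists C => // A AE.
have /boolp.choice[k kP] x : exists y, x \in A -> E y /\ h y = x.
  by have [/AE[y Ey <-]|] := boolP (x \in A); [exists y|exists x].
have -> : A = (h @` (k @` A))%fset.
  rewrite -imfset_comp; apply/fsetP => x; apply/idP/imfsetP => [xA|[y /= yA ->]].
    by exists x => //=; have [] := kP x xA.
  by have [_ ->] := kP y yA.
apply: grows_imfset; first by move=> x y _ _; exact: h_inj.
by apply: growsC => _ /imfsetP[x /= /kP[Ek _] ->].
Qed.

Lemma expands_on_compact f K : compact K ->
  (forall x, K x -> exists2 e : R, 0 < e & expands_on f (ball x e)) -> expands_on f K.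
Proof.
rewrite compact_cover => cK loc.
have /boolp.choice[e eP] : forall x, exists e : R,
    K x -> 0 < e /\ expands_on f (ball x e).
  move=> x; have [Kx|] := pselect (K x); last by exists 0.
  by have [e e0 growsE] := loc x Kx; exists e.
have [|x Kx|D DK KD] := cK R K (fun x => ball x (e x)).
- by move=> x _; exact: ball_open.
- by exists x => //; apply: ballxx; case: (eP x Kx).
apply: expands_onS KD _; rewrite /cover bigcup_fset big_seq.
apply: big_ind => [|E E' HE HE'|x /DK]; [exact: expands_on0|exact: expands_onU|].
by rewrite inE => /eP[].
Qed.

End Expansion.

Section LocalExpansion.
Context {R : realType} (m : nat).
Implicit Types (f g : 'I_m.+1 -> R -> R).

Lemma expands_right g (a : 'I_m.+1 -> nat -> R) r : 0 < r ->
  (forall i, has_pseries (a i) r (g i)) -> independent (fun i => pseries_diffs (a i)) ->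
  \forall eps \near 0^'+, expands_on g [set x | 0 < x < eps].
Proof.
move=> r0 ga ind.
have /boolp.choice[dg dgP] : forall i, exists h,
    has_pseries (pseries_diffs (a i)) r h /\
    forall t : R, `|t| < r -> is_derive t 1 (g i) (h t).
  by move=> i; have [h hh dh] := has_pseries_derive (ga i); exists h.
have [//|p [mu [beta [L [mu_inc betaP trigL L1 aE]]]]] :=
  ex_echelon_decomposition (k0 := 0) ind.
have unitL := unitriangular_unit trigL L1.
have unitVL : invmx L \in unitmx by rewrite unitmx_inv.
pose e j x := \sum_i invmx L j i * dg (p i) x.
have eP j : has_pseries (beta j) r (e j).
  have -> : beta j = fun k => \sum_i invmx L j i * pseries_diffs (a (p i)) k.
    apply/funext => k.
    exact: (mulmx_invl_sum (v := beta^~ k) unitL (fun i => aE i k)).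
  by apply: has_pseries_sum => i; case: (dgP (p i)).
pose c j := beta j (mu j).
have ech : echelon_form mu c L by split=> // j; have [] := betaP j.
have [C C0 /near_right_ex[dl dl0 growP]] := echelon_uniform_growth ech.
have powP : \forall eps \near 0^'+, forall j,
    power_like m [set x | 0 < x < eps] dl (c j) (mu j) (e j).
  apply: filter_forall => j.
  apply: (has_pseries_power_like m (mu := mu j) r0 dl0 (eP j)) => k.
  by rewrite ltz_nat; have [_ _] := betaP j; exact.
apply: filterS3 powP (nbhs_right_le dl0) (nbhs_right_le r0) => eps powP eps_dl eps_r.
exists C => // A A_eps.
suff [i iC] : grows C (fun i => g (p i)) A by exists (p i).
apply: (growP [set x | 0 < x < eps] _ e) => //; split=> //.
- by rewrite -set_itvoo; exact: interval_open.
- by rewrite -set_itvoo; exact: interval_is_interval.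
- by move=> x /andP[-> /lt_le_trans]; exact.
move=> i x /andP[x0 xe]; have -> : \sum_j L i j * e j x = dg (p i) x.
  have -> : dg (p i) x = \sum_j invmx (invmx L) i j * e j x.
    exact: (mulmx_invl_sum (v := fun i => dg (p i) x) unitVL (fun=> erefl)).
  by rewrite invmxK.
by have [_] := dgP (p i); apply; rewrite gtr0_norm // (lt_le_trans xe).
Qed.

Lemma analytic_at_has_pseries (h : R -> R) x : analytic_at h x ->
  \forall r \near 0^'+, exists b, has_pseries b r (fun t => h (x + t)).
Proof.
move=> [r r0 [b ps]]; apply: filterS (nbhs_right_le r0) => r' r'r; exists b.
apply: (has_pseriesW r'r) => t tr.
by have := ps (x + t); rewrite addrAC subrr add0r; exact.
Qed.

Lemma has_pseries_derive1 b r (h : R -> R) x : has_pseries b r (fun t => h (x + t)) ->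
  has_pseries (pseries_diffs b) r (fun t => derive1 h (x + t)).
Proof.
move=> /has_pseries_derive[h' hh' dh] t tr.
suff -> : derive1 h (x + t) = h' t by exact: hh'.
have d_shift : is_derive (x + t) 1 (fun y => y - x) (1 : R).
  apply: is_derive_eq (is_deriveB (is_derive_id _ _) (is_derive_cst x _ _)) _.
  exact: subr0.
have dht : is_derive (x + t - x) 1 (fun t => h (x + t)) (h' t).
  by rewrite addrAC subrr add0r; exact: dh.
have := @is_derive1_comp R (fun t => h (x + t)) (fun y => y - x) _ _ _ dht d_shift.
rewrite (_ : _ \o _ = h); last by apply/funext => y /=; rewrite addrC subrK.
by rewrite mulr1 derive1E => -[].
Qed.

Lemma one_independent_pseries (J : set R) f x0 (a : 'I_m.+1 -> nat -> R) r :
  is_interval J -> (forall i, analytic_on J (f i)) -> one_independent_on J f -> J x0 ->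
  0 < r -> (forall i, has_pseries (a i) r (fun t => f i (x0 + t))) ->
  independent (fun i => pseries_diffs (a i)).
Proof.
move=> iJ an ind Jx0 r0 fa c ca; apply: ind => x Jx.
apply: (identity_theorem iJ _ Jx0 _ Jx (h := fun x => \sum_i c i * derive1 (f i) x)).
  move=> y Jy; have /near_right_ex[s s0 /boolp.choice[b fb]] :
      \forall s \near 0^'+, forall i, exists b, has_pseries b s (fun t => f i (y + t)).
    by apply: filter_forall => i; exact/analytic_at_has_pseries/an.
  exists s => //; exists (fun k => \sum_i c i * pseries_diffs (b i) k).
  by apply: has_pseries_sum => i; exact/has_pseries_derive1/fb.
have sum_ps := has_pseries_sum (c := c) (fun i => has_pseries_derive1 (fa i)).
apply/nbhs_ballP; exists r => // y; rewrite /ball /= distrC => yr.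
by have := has_pseries_eq0 sum_ps ca yr; rewrite /= (addrC x0) subrK.
Qed.

Lemma expands_locally (J : set R) f (x0 : R) : is_interval J ->
  (forall i, analytic_on J (f i)) -> one_independent_on J f -> J x0 ->
  exists2 e : R, 0 < e & expands_on f (ball x0 e).
Proof.
move=> iJ an ind Jx0; have /near_right_ex[r r0 /boolp.choice[a fa]] :
    \forall r \near 0^'+, forall i, exists b, has_pseries b r (fun t => f i (x0 + t)).
  by apply: filter_forall => i; exact: analytic_at_has_pseries (an i x0 Jx0).
have ind_a := one_independent_pseries iJ an ind Jx0 r0 fa.
have fa' i := has_pseriesN (fa i).
have ind_a' : independent (fun i => pseries_diffs (fun k => (-1) ^+ k * a i k)).
  have := independentZ (w := fun k => (-1) ^+ k.+1)
    (fun k => negbT (signr_eq0 _ _)) ind_a.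
  congr independent; apply/funext => i; apply/funext => k.
  by rewrite /pseries_diffs mulrCA.
have [e [e0 [right left]]] := filter_ex (filterI (nbhs_right_gt 0)
  (filterI (expands_right r0 fa ind_a) (expands_right r0 fa' ind_a'))).
exists e => //; have right_inj : injective (+%R x0) by exact: addrI.
have left_inj : injective (fun t => x0 - t) by move=> x y /addrI/oppr_inj.
apply: expands_onS (expands_onU (expands_on1 f x0) (expands_onU
  (expands_on_image right_inj right) (expands_on_image left_inj left))) => x.
rewrite /ball /= => xe; have [xx0|xx0|->] := ltgtP x x0; last by left.
  right; right; exists (x0 - x); last by rewrite subKr.
  by move: xe; rewrite gtr0_norm subr_gt0 ?xx0.
right; left; exists (x - x0); last by rewrite addrC subrK.
by move: xe; rewrite distrC gtr0_norm subr_gt0 ?xx0.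
Qed.

End LocalExpansion.

Theorem theorem1p9 (R : realType) (a b : R) (leab : a <= b)
    (n : nat) (n_gt0 : (0 < n)%N) (J : set R)
    (openJ : open J) (itvJ : is_interval J) (subIJ : `[a, b]%classic `<=` J)
    (f : 'I_n -> R -> R)
    (anf : forall i, analytic_on J (f i))
    (indf : one_independent_on J f) :
  exists2 C : R, 0 < C &
    forall A : {fset R}, (forall x, x \in A -> x \in `[a, b]) ->
      exists i : 'I_n,
        (#|` sumdiff (2 ^ (n - 1)) (2 ^ (n - 1) - 1) (f i @` A)%fset|)%:R
          >= C * (#|` A|)%:R `^ phi R n.
Proof.
case: n n_gt0 f anf indf => // m _ f anf indf; rewrite subn1 /=.
have [x Ix|C C0 growsC] :=
    expands_on_compact (f := f) (segment_compact (a := a) (b := b)).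
  exact: expands_locally itvJ anf indf (subIJ x Ix).
exists C => // A A_ab; have [|i iC] := growsC A; first by move=> x /A_ab.
exists i; apply: le_trans iC _; rewrite ler_nat.
exact/fsubset_leq_card/sumdiff_between_sub.
Qed.
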